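(* Let $A$ be a commutative integral domain, $u$ a unit of $A$, and $m\le n$ positive integers. For all $I,J\in\Pi_{m,n}$ there exist $f_{I,J}\in\mathbb Z$ and elements $k_{L,M}\in A$ such that in $\mathcal O_u(G_{m,n}(A))$ $$[I][J]-u^{f_{I,J}}[J][I]=\sum k_{L,M}[L][M],$$ where the sum is over pairs $(L,M)$ of elements of $\Pi_{m,n}$ with $L<_{\rm st}I$, $L<_{\rm st}J$ and $L\le_{\rm st}M$.
   Context: For a field $F$ and $u\in F^\ast$, $\mathcal O_u(M_{m,n}(F))$ is the $F$-algebra generated by $X_{ij}$ ($1\le i\le m$, $1\le j\le n$) subject to: $X_{ij}X_{il}=uX_{il}X_{ij}$ for $j<l$; $X_{ij}X_{kj}=uX_{kj}X_{ij}$ for $i<k$; $X_{ij}X_{kl}=X_{kl}X_{ij}$ for $k<i$, $j<l$; $X_{ij}X_{kl}-X_{kl}X_{ij}=(u-u^{-1})X_{il}X_{kj}$ for $i<k$, $j<l$. For a commutative domain $A$ with fraction field $F$ and unit $u$, $\mathcal O_u(M_{m,n}(A))$ is the $A$-subalgebra of $\mathcal O_u(M_{m,n}(F))$ generated by the $X_{ij}$. $\Pi_{m,n}$ is the set of $m$-subsets $\{j_1<\dots<j_m\}$ of $\{1,\dots,n\}$, ordered by $\{i_1<\dots<i_m\}\le_{\rm st}\{j_1<\dots<j_m\}$ iff $i_s\le j_s$ for all $s$; $[J]=\sum_{\sigma\in\mathfrak S_m}(-u)^{\ell(\sigma)}X_{1j_{\sigma(1)}}\cdots X_{mj_{\sigma(m)}}$.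 $\mathcal O_u(G_{m,n}(A))$ is the $A$-subalgebra of $\mathcal O_u(M_{m,n}(A))$ generated by all $[J]$. *)

(* Defs.v *)
From HB Require Import structures.
From mathcomp Require Import all_boot all_order all_algebra all_fingroup.
From mathcomp Require Import fraction.
Set Implicit Arguments. Unset Strict Implicit. Unset Printing Implicit Defensive.
Import Order.TTheory GRing.Theory Num.Theory.
Local Open Scope ring_scope.

Definition idx (m n : nat) := ('I_m * 'I_n)%type.

(* Elements of the free F-algebra F<X_ij> represented as finite formal sums
   of (coefficient, word) pairs; two formal sums are equal in the free algebra
   iff they have the same coefficient on every word (see [ncoef]). *)
Definition ncpoly (F : fieldType) (m n : nat) := seq (F * seq (idx m n)).

Section NC.
Variables (F : fieldType) (m n : nat).
Local Notation P := (ncpoly F m n).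

Definition ncoef (p : P) (w : seq (idx m n)) : F :=
  \sum_(t <- p | t.2 == w) t.1.
Definition ncadd (p q : P) : P := p ++ q.
Definition ncscale (c : F) (p : P) : P := [seq (c * t.1, t.2) | t <- p].
Definition ncsub (p q : P) : P := p ++ ncscale (-1) q.
Definition ncmul (p q : P) : P :=
  [seq (a.1 * b.1, a.2 ++ b.2) | a <- p, b <- q].
Definition ncword (w : seq (idx m n)) : P := [:: (1, w)].

(* The defining relations of O_u(M_{m,n}(F)), written as elements r with r = 0. *)
Definition is_qrel (u : F) (r : P) : Prop :=
  exists (i k : 'I_m) (j l : 'I_n),
    [/\ i = k, (j < l)%N &
        r = [:: (1, [:: (i, j); (i, l)]); (- u, [:: (i, l); (i, j)])]]
 \/ [/\ j = l, (i < k)%N &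
        r = [:: (1, [:: (i, j); (k, j)]); (- u, [:: (k, j); (i, j)])]]
 \/ [/\ (k < i)%N, (j < l)%N &
        r = [:: (1, [:: (i, j); (k, l)]); (-1, [:: (k, l); (i, j)])]]
 \/ [/\ (i < k)%N, (j < l)%N &
        r = [:: (1, [:: (i, j); (k, l)]); (-1, [:: (k, l); (i, j)]);
                (- (u - u^-1), [:: (i, l); (k, j)])]].

(* p lies in the two-sided ideal generated by the relations, i.e. p = 0 in
   O_u(M_{m,n}(F)): p equals (coefficientwise) a finite F-linear combination
   of terms a * r * b with a, b words and r a defining relation. *)
Definition in_qideal (u : F) (p : P) : Prop :=
  exists s : seq (F * seq (idx m n) * P * seq (idx m n)),
    (forall t, t \in s -> is_qrel u t.1.2) /\
    forall w, ncoef p w =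
      ncoef (flatten [seq ncscale t.1.1.1
                        (ncmul (ncword t.1.1.2) (ncmul t.1.2 (ncword t.2)))
                     | t <- s]) w.

Definition qeq (u : F) (p q : P) : Prop := in_qideal u (ncsub p q).

(* Elements of Pi_{m,n}: an m-subset {j_1 < ... < j_m} of {1..n} is
   represented by the strictly increasing map s |-> j_s. *)
Definition is_Pi (J : {ffun 'I_m -> 'I_n}) : bool :=
  [forall s : 'I_m, forall t : 'I_m, (s < t)%N ==> (J s < J t)%N].

Definition le_st (I J : {ffun 'I_m -> 'I_n}) : bool :=
  [forall s : 'I_m, (I s <= J s)%N].
Definition lt_st (I J : {ffun 'I_m -> 'I_n}) : bool := le_st I J && (I != J).

Definition perm_length (s : {perm 'I_m}) : nat :=
  #|[set p : 'I_m * 'I_m | (p.1 < p.2)%N && (s p.2 < s p.1)%N]|.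

Definition qminor (u : F) (J : {ffun 'I_m -> 'I_n}) : P :=
  [seq ((- u) ^+ perm_length s, [seq (i, J (s i)) | i <- enum 'I_m])
  | s <- enum {perm 'I_m}].

End NC.

(* Main.v *)
Require Import Defs.
From HB Require Import structures.
From mathcomp Require Import all_boot all_order all_algebra all_fingroup.
From mathcomp Require Import fraction generic_quotient.
From mathcomp Require Import boolp.
From mathcomp Require Import ring zify.
Set Implicit Arguments. Unset Strict Implicit. Unset Printing Implicit Defensive.
Import Order.TTheory GRing.Theory Num.Theory.
Local Open Scope ring_scope.

(** The proof works in an arbitrary F-algebra carrying a matrix X that satisfies
the relations, with coefficients that do not depend on it; the quotient of the
free algebra by the relations is only used at the very end.

Expanding minors along rows and along columns gives quantum Plücker relations,
and these rewrite every product [I][J] as an A-combination of standard products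
[L][M], L <= M, by induction on the sum of the entries of I.  This straightening
carries no information on L.  That information comes from a family of
representations: for L <= M there is a representation by matrices over F in
which X_ij = 0 unless L_i <= j <= M_i and in which [L][M] <> 0.  There [K]
vanishes unless L <= K <= M, and [L] = X_1L_1 ... X_mL_m skew-commutes with all
X_ij, so that [L][J] = u^f [J][L] with f = #|J \ L|.  Hence, with f chosen
accordingly when I and J are comparable, [I][J] - u^f [J][I] vanishes in the
representation of every (L, M) for which L < I or L < J fails, and all
coefficients of its straightening at such (L, M) vanish, by induction on the
size of M - L. *)

(** * Recursive quantum minors *)

Section QMatrix.
Variables (F : fieldType) (u : F) (S : algType F).

Definition qmat r c (X : 'I_r -> 'I_c -> S) : Prop :=
  [/\ forall i (j l : 'I_c), (j < l)%N -> X i j * X i l = u *: (X i l * X i j),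
      forall (i k : 'I_r) j, (i < k)%N -> X i j * X k j = u *: (X k j * X i j),
      forall (i k : 'I_r) (j l : 'I_c), (i < k)%N -> (j < l)%N ->
        X k j * X i l = X i l * X k j
    & forall (i k : 'I_r) (j l : 'I_c), (i < k)%N -> (j < l)%N ->
        X i j * X k l - X k l * X i j = (u - u^-1) *: (X i l * X k j)].

Lemma qmat_tr r c (X : 'I_r -> 'I_c -> S) :
  qmat X -> qmat (fun j i => X i j).
Proof.
case=> h1 h2 h3 h4; split.
- by move=> i j l jl; apply: h2.
- by move=> i k j ik; apply: h1.
- by move=> i k j l ik jl; rewrite (h3 j l i k).
- by move=> i k j l ik jl; rewrite (h4 j l i k) // (h3 j l i k).
Qed.

Definition below c (K : {set 'I_c}) (x : 'I_c) : nat := (\sum_(y in K) (y < x))%N.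

(** Laplace expansion along the first listed row. Rows form a sequence, so that they can be permuted
    and repeated; columns form a set. *)
Fixpoint minor r c (X : 'I_r -> 'I_c -> S) (a : seq 'I_r) (K : {set 'I_c}) : S :=
  if a is i :: a' then
    \sum_(x in K) (- u) ^+ below K x *: (X i x * minor X a' (K :\ x))
  else (K == set0)%:R.

Lemma below_setD1 c (K : {set 'I_c}) (x y : 'I_c) :
  x \in K -> below K y = ((x < y)%N + below (K :\ x) y)%N.
Proof.
move=> xK; rewrite /below (bigD1 x) //=; congr (_ + _)%N.
by apply: eq_bigl => z; rewrite !inE andbC.
Qed.

Lemma below_setID c (K P : {set 'I_c}) (x : 'I_c) :
  P \subset K -> below K x = (below P x + below (K :\: P) x)%N.
Proof. by move=> PK; rewrite /below (big_setID P) /= (setIidPr PK). Qed.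

Lemma sum_pairs c (K : {set 'I_c}) (f : 'I_c -> 'I_c -> S) :
  \sum_(x in K) \sum_(y in K :\ x) f x y =
  \sum_(x in K) \sum_(y in K | (x < y)%N) (f x y + f y x).
Proof.
under [RHS]eq_bigr => x _ do rewrite big_split.
rewrite big_split /= [X in _ = _ + X](exchange_big_dep (mem K)) /=; last by move=> x y ? /andP[].
rewrite -big_split /=; apply: eq_bigr => x xK.
rewrite (bigID (fun y : 'I_c => (x < y)%N)) /=; congr (_ + _); apply: eq_bigl => y.
  by rewrite !inE; case: ltngtP => //; rewrite ?andbF //; case: eqVneq => // ->; rewrite ltnn.
rewrite !inE xK /= andbC -leqNgt leq_eqVlt andbA -val_eqE /=.
by case: ltngtP; rewrite ?andbF ?andbT.
Qed.

(** * Row exchanges, vanishing and Laplace expansion of minors *)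

Section Rows.
Variables (r c : nat) (X : 'I_r -> 'I_c -> S).
Hypotheses (u0 : u != 0) (qX : qmat X).
Local Notation D := (minor X).

(** Taking two columns [x < y] in the opposite order costs one more factor [- u], so the first two
    rows contribute their 2 x 2 quantum minors. *)
Lemma minor_two i k a K :
  D (k :: i :: a) K =
  \sum_(x in K) \sum_(y in K | (x < y)%N)
     (- u) ^+ (below K x + below (K :\ x) y) *:
       ((X k x * X i y - u *: (X k y * X i x)) * D a (K :\ x :\ y)).
Proof.
rewrite /=.
under eq_bigr => x xK.
  rewrite mulr_sumr scaler_sumr.
  under eq_bigr => y yK do rewrite -scalerAr mulrA scalerA -exprD.
  over.
rewrite sum_pairs; apply: eq_bigr => x xK; apply: eq_bigr => y /andP[yK xy].
have -> : K :\ y :\ x = K :\ x :\ y by rewrite !setDDl setUC.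
have -> : (below K y + below (K :\ y) x = (below K x + below (K :\ x) y).+1)%N.
  by rewrite (below_setD1 y xK) (below_setD1 x yK) xy ltnNge (ltnW xy) /= add0n add1n addSn addnC.
by rewrite exprS mulrBl scalerBr mulNr scaleNr -scalerAl !scalerA mulrC.
Qed.

Lemma minor_same i a K : D (i :: i :: a) K = 0.
Proof.
case: qX => h1 _ _ _.
rewrite minor_two big1 // => x _; rewrite big1 // => y /andP[_ xy].
by rewrite (h1 _ _ _ xy) subrr mul0r scaler0.
Qed.

(** It suffices to compare 2 x 2 minors on the rows [i] and [k]; the commutator relation and the
    commutation of antidiagonal entries give the factor. *)
Lemma minor_swap (i k : 'I_r) a K : (i < k)%N ->
  D (k :: i :: a) K = - u *: D (i :: k :: a) K.
Proof.
move=> ik; case: qX => h1 h2 h3 h4.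
rewrite !minor_two !scaler_sumr; apply: eq_bigr => x _.
rewrite scaler_sumr; apply: eq_bigr => y /andP[_ xy].
rewrite scalerA mulrC -scalerA; congr (_ *: _); rewrite [RHS]scalerAl; congr (_ * _).
have := h4 _ _ _ _ ik xy; rewrite (h3 _ _ _ _ ik xy) => h.
have -> : X k y * X i x = X i x * X k y - (u - u^-1) *: (X i y * X k x).
  by rewrite -h opprB addrC subrK.
rewrite scaleNr !scalerBr !scalerA mulrBr divff // scalerBl scale1r.
by rewrite !opprB addrA addrCA subrr addr0.
Qed.

Lemma minor_cons0 i a (K : {set 'I_c}) : (forall K' : {set 'I_c}, D a K' = 0) -> D (i :: a) K = 0.
Proof. by move=> a0; rewrite /= big1 // => x _; rewrite a0 mulr0 scaler0. Qed.

(** Vanishing passes through an exchange in either direction, because [- u] can be cancelled. *)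
Lemma minor_swap0 (i k : 'I_r) a :
  (forall K : {set 'I_c}, D (i :: k :: a) K = 0) -> forall K : {set 'I_c}, D (k :: i :: a) K = 0.
Proof.
move=> ik0 K; case: (ltngtP i k) => [ik|ki|/val_inj-> //]; last exact: minor_same.
  by rewrite minor_swap // ik0 scaler0.
have := minor_swap a K ki; rewrite ik0 => /esym/eqP.
by rewrite scaler_eq0 oppr_eq0 (negPf u0) => /eqP.
Qed.

(** Adjacent exchanges bring the row [i] next to its other copy. *)
Lemma minor_mem0 i a (K : {set 'I_c}) : i \in a -> D (i :: a) K = 0.
Proof.
elim: a K => [//|k a IHa] K; rewrite inE; case: eqVneq => [<- _|_ /= ia].
  exact: minor_same.
by apply: minor_swap0 => K'; apply: minor_cons0 => K''; apply: IHa.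
Qed.

Lemma minor_notuniq a (K : {set 'I_c}) : ~~ uniq a -> D a K = 0.
Proof.
elim: a K => [//|i a IHa] K /=; rewrite negb_and negbK => /orP[ia|na].
  exact: minor_mem0.
by apply: minor_cons0 => K'; apply: IHa.
Qed.

Lemma minor_size0 a (K : {set 'I_c}) : size a != #|K| -> D a K = 0.
Proof.
elim: a K => [|i a IHa] K /= szK.
  by rewrite -cards_eq0 eq_sym (negPf szK).
rewrite big1 // => x xK; rewrite IHa ?mulr0 ?scaler0 //.
by move: szK; rewrite (cardsD1 x K) xK.
Qed.

(** Either a row repeats or there are fewer rows than columns. This vanishing is the source of the
    Plücker relations. *)
Lemma minor_large0 a (K : {set 'I_c}) : (r < #|K|)%N -> D a K = 0.
Proof.
move=> rK; have [ua|] := boolP (uniq a); last exact: minor_notuniq.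
apply: minor_size0; apply: contraTneq rK => <-.
by rewrite -leqNgt -[X in (_ <= X)%N]card_ord -(card_uniqP ua) max_card.
Qed.

(** Number of inversions created by listing all of [P] before all of [Q]. *)
Definition cross (P Q : {set 'I_c}) : nat := (\sum_(x in P) below Q x)%N.

(** Laplace expansion along several rows. In the induction, a first column [x] together with a
    column set for the rest of [a] amounts to a set [P] with a marked element [x]. *)
Lemma minor_cat a b K :
  D (a ++ b) K = \sum_(P : {set 'I_c} | P \subset K)
     (- u) ^+ cross P (K :\: P) *: (D a P * D b (K :\: P)).
Proof.
elim: a K => [|i a IHa] K.
  rewrite (bigD1 set0) ?sub0set //= eqxx /cross big_set0 setD0 mul1r scale1r.
  by rewrite big1 ?addr0 // => P /andP[_ /negPf->]; rewrite mul0r scaler0.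
rewrite /=.
under eq_bigr => x xK do rewrite IHa mulr_sumr scaler_sumr.
under [RHS]eq_bigr => P PK do rewrite mulr_suml scaler_sumr.
rewrite [RHS](exchange_big_dep (mem K)) /=; last by move=> P x /subsetP PK /PK.
apply: eq_bigr => x xK.
rewrite [RHS](reindex_onto (fun P => x |: P) (fun P => P :\ x)) /=; last first.
  by move=> P /andP[_ xP]; rewrite setD1K.
apply: eq_big => [P|P PK].
  rewrite subUset sub1set xK setU11 andbT subsetD1; congr (_ && _).
  apply/idP/eqP => [xP|<-]; last by rewrite !inE eqxx.
  by rewrite setU1K.
have xP : x \notin P by apply: contraL PK => xP; rewrite subsetD1 xP andbF.
rewrite setU1K // setDDl; set Q := K :\: (x |: P).
rewrite -!scalerAr -!scalerAl !scalerA !mulrA -!exprD; congr (_ ^+ _ *: _).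
rewrite (below_setID x (_ : x |: P \subset K)) -/Q; last first.
  by rewrite subUset sub1set xK (subset_trans PK) ?subsetDl.
by rewrite /cross big_setU1 //= -addnA addnC.
Qed.

End Rows.

(** * Increasing enumerations and transposition of minors *)

Lemma enum_sorted c (B : {set 'I_c}) : sorted (relpre val ltn) (enum B).
Proof.
rewrite -sorted_map /enum_mem; apply: (subseq_sorted ltn_trans).
  by apply: map_subseq; apply: filter_subseq.
by rewrite -enumT val_enum_ord iota_ltn_sorted.
Qed.

Lemma enum_min c (A : {set 'I_c}) (x : 'I_c) :
  x \in A -> (forall y, y \in A -> (x <= y)%N) -> enum A = x :: enum (A :\ x).
Proof.
move=> xA xmin; apply: (@irr_sorted_eq _ (relpre val ltn)).
- by move=> y x' z /=; apply: ltn_trans.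
- by move=> y /=; rewrite ltnn.
- exact: enum_sorted.
- rewrite /= path_sortedE; last by move=> y x' z /=; apply: ltn_trans.
  rewrite enum_sorted andbT; apply/allP=> y; rewrite mem_enum !inE => /andP[yx yA] /=.
  by rewrite ltn_neqAle xmin // andbT eq_sym.
- by move=> y; rewrite mem_enum !inE mem_enum !inE; case: eqVneq => // ->.
Qed.

Lemma set_min c (A : {set 'I_c}) :
  A != set0 -> {x | x \in A & forall y, y \in A -> (x <= y)%N}.
Proof.
by move=> /set0Pn/sigW[x0 x0A]; case: (arg_minnP val x0A) => x xA xmin; exists x.
Qed.

Lemma below_min c (A : {set 'I_c}) (x : 'I_c) :
  (forall y, y \in A -> (x <= y)%N) -> below A x = 0%N.
Proof. by move=> xmin; apply: big1 => y /xmin; case: ltnP. Qed.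

(* Expand one side along the first row and the other along the first column;
   the leftover pairs of entries are in antidiagonal position, hence commute. *)
Lemma minor_tr r c (X : 'I_r -> 'I_c -> S) (A : {set 'I_r}) (P : {set 'I_c}) :
  qmat X -> minor X (enum A) P = minor (fun j i => X i j) (enum P) A.
Proof.
case=> _ _ h3 _; have [N] := ubnP #|A|.
elim: N A P => // N IHN A P; rewrite ltnS => AN.
have [->|A0] := eqVneq A set0.
  rewrite enum_set0 /=; have [->|P0] := eqVneq P set0; first by rewrite enum_set0 /= eqxx.
  by have [p pP pmin] := set_min P0; rewrite (enum_min pP pmin) /= big_set0.
have [a aA amin] := set_min A0.
have [->|P0] := eqVneq P set0.
  by rewrite enum_set0 (enum_min aA amin) /= big_set0 (negPf A0).
have [p pP pmin] := set_min P0.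
have AaN : (#|A :\ a| < N)%N by rewrite (leq_trans _ AN) // [X in (_ < X)%N](cardsD1 a) aA.
have minD c' (B : {set 'I_c'}) (b y : 'I_c') : (forall z, z \in B -> (b <= z)%N) ->
    forall z, z \in B :\ y -> (b <= z)%N by move=> bB z /setD1P[_ /bB].
rewrite (enum_min aA amin) (enum_min pP pmin) /=.
rewrite (bigD1 p) //= [RHS](bigD1 a) //=.
(* The two corner terms with [X a p] agree by induction. All other terms become double sums over a
   further column [x] and a further row [y]. *)
rewrite !below_min // !expr0 !scale1r IHN //; congr (_ + _).
rewrite (eq_bigl (mem (P :\ p))) /=; last by move=> x; rewrite !inE andbC.
rewrite [RHS](eq_bigl (mem (A :\ a))) /=; last by move=> x; rewrite !inE andbC.
transitivity (\sum_(x in P :\ p) \sum_(y in A :\ a)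
  (- u) ^+ (below P x + below (A :\ a) y) *: (X a x * X y p *
     minor (fun j i => X i j) (enum (P :\ p :\ x)) (A :\ a :\ y))).
  apply: eq_bigr => x xP; rewrite IHN //.
  have px : p \in P :\ x by move: xP; rewrite !inE pP andbT eq_sym => /andP[].
  rewrite (enum_min px (minD _ _ _ _ pmin)) /= mulr_sumr scaler_sumr.
  apply: eq_bigr => y yA; rewrite -scalerAr scalerA -exprD mulrA.
  by rewrite !setDDl [[set x] :|: _]setUC.
rewrite exchange_big /=; apply: eq_bigr => y yA.
have yA' : y \in A by case/setD1P: yA.
have ay : a \in A :\ y by move: yA; rewrite !inE aA andbT eq_sym => /andP[].
have ya : (a < y)%N by rewrite ltn_neqAle amin // andbT; case/setD1P: yA => + _; rewrite eq_sym.
rewrite -IHN; last by rewrite (leq_trans _ AN) // [X in (_ < X)%N](cardsD1 y) yA'.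
rewrite (enum_min ay (minD _ _ _ _ amin)) /= mulr_sumr scaler_sumr.
apply: eq_bigr => x xP; rewrite -scalerAr scalerA -exprD mulrA.
have xP' : x \in P by case/setD1P: xP.
have px : (p < x)%N by rewrite ltn_neqAle pmin // andbT; case/setD1P: xP => + _; rewrite eq_sym.
rewrite (h3 _ _ _ _ ya px) (below_setD1 x pP) (below_setD1 y aA) px ya.
rewrite IHN; last first.
  by rewrite (leq_ltn_trans _ AaN) // !setDDl setUC -setDDl subset_leq_card ?subsetDl.
by rewrite addnAC !setDDl [[set y] :|: _]setUC.
Qed.
End QMatrix.

(** * Plücker relations *)

Section Expansion.
Variables (F : fieldType) (u : F) (S : algType F).
Hypothesis u0 : u != 0.
Local Notation minor := (minor u).

Lemma below_setD1id c (K : {set 'I_c}) (x : 'I_c) : below (K :\ x) x = below K x.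
Proof.
case: (boolP (x \in K)) => xK; first by rewrite (below_setD1 x xK) ltnn.
by congr below; apply/setP => y; rewrite !inE; case: eqVneq => // ->; rewrite (negPf xK).
Qed.

(** On a duplicate-free sequence this is the inversion number, the exponent of [- u] that sorting
    costs. *)
Fixpoint inv_seq c (a : seq 'I_c) : nat :=
  if a is x :: s then (below [set y in s] x + inv_seq s)%N else 0%N.

(** * Sorting the rows of a minor *)

Section Sorting.
Variables (r c : nat) (X : 'I_r -> 'I_c -> S).
Hypothesis qX : qmat u X.

(** On its way to its sorted place [x] passes exactly the elements of [B] below it, and each
    exchange costs [- u]. *)
Lemma minor_cons_enum x (B : {set 'I_r}) (K : {set 'I_c}) : x \notin B ->
  minor X (x :: enum B) K = (- u) ^+ below B x *: minor X (enum (x |: B)) K.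
Proof.
have [N] := ubnP #|B|; elim: N B K => // N IHN B K; rewrite ltnS => BN xB.
have [x_min|] := boolP [forall y in B, (x <= y)%N].
  have {}x_min y : y \in B -> (x <= y)%N by move/(forall_inP x_min).
  rewrite below_min // expr0 scale1r (@enum_min _ (x |: B) x) ?setU11 ?setU1K //.
  by move=> y /setU1P[->|/x_min].
rewrite negb_forall_in => /exists_inP[y yB]; rewrite -ltnNge => yx.
have [b bB bmin] : {b | b \in B & forall z, z \in B -> (b <= z)%N}.
  by apply: set_min; apply/set0Pn; exists y.
have bx : (b < x)%N by apply: leq_ltn_trans (bmin _ yB) yx.
rewrite (enum_min bB bmin) (minor_swap u0 qX _ _ bx) (below_setD1 x bB) bx exprS -scalerA.
congr (_ *: _); rewrite (@enum_min _ (x |: B) b) ?inE ?bB ?orbT //; last first.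
  by move=> z /setU1P[->|/bmin //]; apply: ltnW.
have -> : (x |: B) :\ b = x |: (B :\ b).
  by apply/setP => z; rewrite !inE; case: (z =P x) => //= ->; rewrite andbT neq_ltn bx orbT.
rewrite /= scaler_sumr; apply: eq_bigr => z _.
rewrite -/(minor X (x :: enum (B :\ b)) (K :\ z)) IHN.
- by rewrite -scalerAr !scalerA mulrC.
- by rewrite (leq_trans _ BN) // [X in (_ < X)%N](cardsD1 b) bB.
- by rewrite !inE negb_and xB orbT.
Qed.

Lemma minor_sort a (K : {set 'I_c}) : uniq a ->
  minor X a K = (- u) ^+ inv_seq a *: minor X (enum [set x in a]) K.
Proof.
elim: a K => [|x a IHa] K.
  rewrite scale1r (_ : [set x : 'I_r in [::]] = set0) ?enum_set0 //.
case/andP=> xa ua; transitivity ((- u) ^+ inv_seq a *: minor X (x :: enum [set x in a]) K).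
  rewrite /= scaler_sumr; apply: eq_bigr => z _; rewrite IHa //.
  by rewrite -scalerAr !scalerA mulrC.
rewrite minor_cons_enum ?inE // scalerA -exprD addnC /=.
have -> // : [set y in x :: a] = x |: [set y in a].
by apply/setP => y; rewrite !inE.
Qed.
End Sorting.

Section Plucker.
Variables (r c : nat) (X : 'I_r -> 'I_c -> S).
Hypothesis qX : qmat u X.

(** Expand the factors along [a] and [b] and transpose what remains. For fixed row sets [A] and [B],
    the sum over [P] is then the Laplace expansion of a minor of [X] with column set [K], which has
    more elements than [X] has rows. *)
Lemma plucker (a b : seq 'I_c) (K : {set 'I_c}) : (r < #|K|)%N ->
  \sum_(P : {set 'I_c} | P \subset K) (- u) ^+ cross P (K :\: P) *:
    (minor (fun j i => X i j) (a ++ enum P) setT *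
     minor (fun j i => X i j) (enum (K :\: P) ++ b) setT) = 0.
Proof.
move=> rK; have qXt := qmat_tr qX; set Xt := fun j i => X i j.

pose L A := minor Xt a A; pose R B := minor Xt b (setT :\: B).
pose cf (A B : {set 'I_r}) := (- u) ^+ (cross A (setT :\: A) + cross B (setT :\: B)).
transitivity (\sum_(A : {set 'I_r}) \sum_(B : {set 'I_r}) cf A B *: (L A *
    minor X (enum (setT :\: A) ++ enum B) K * R B)); last first.
  by rewrite big1 // => A _; rewrite big1 // => B _; rewrite minor_large0 // mulr0 mul0r scaler0.
transitivity (\sum_(P : {set 'I_c} | P \subset K) \sum_A \sum_B cf A B *: (L A *
    ((- u) ^+ cross P (K :\: P) *:
      (minor X (enum (setT :\: A)) P * minor X (enum B) (K :\: P))) * R B)).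
  apply: eq_bigr => P PK; rewrite !minor_cat // big_distrlr /= scaler_sumr.
  apply: eq_big => [A|A _]; first by rewrite subsetT.
  rewrite scaler_sumr; apply: eq_big => [B|B _]; first by rewrite subsetT.
  rewrite -!(minor_tr _ _ qX) -!(scalerAl, scalerAr) !scalerA !mulrA.
  rewrite /cf -!exprD; congr (_ ^+ _ *: _); lia.
rewrite exchange_big; apply: eq_bigr => A _; rewrite exchange_big; apply: eq_bigr => B _.
by rewrite minor_cat // mulr_sumr mulr_suml scaler_sumr.
Qed.
End Plucker.
End Expansion.

(** * Minors as sums over permutations *)

Section QDet.
Variables (F : fieldType) (u : F) (S : algType F).
Hypothesis u0 : u != 0.
Local Notation minor := (minor u).

(** The recursion fully unfolded: [b] lists the columns chosen row by row. This is the bridge from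
    recursive minors to sums over permutations. *)
Lemma minor_expand r c (X : 'I_r -> 'I_c -> S) (a : seq 'I_r) (K : {set 'I_c}) :
  minor X a K = \sum_(b : (size a).-tuple 'I_c | uniq b && ([set y in b] == K))
     (- u) ^+ inv_seq b *: \prod_(p <- zip a b) X p.1 p.2.
Proof.
elim: a K => [|i a IHa] K.
  rewrite big_mkcond (big_pred1 [tuple]) /=; last by move=> b; apply/esym/eqP; rewrite [b]tuple0.
  by rewrite big_nil scale1r set_nil eq_sym; case: eqP.
rewrite /=; under eq_bigr => x _ do rewrite IHa mulr_sumr scaler_sumr.
pose h (b : (size a).+1.-tuple 'I_c) := (thead b, [tuple of behead b]).
pose h' (p : 'I_c * (size a).-tuple 'I_c) := [tuple of p.1 :: p.2].
rewrite [RHS](reindex h') /=; last first.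
  apply: onW_bij; exists h => [[x b]|b]; last by rewrite [RHS]tuple_eta.
  by congr (_, _); apply: val_inj.
rewrite pair_big_dep /=; apply: eq_big => [[x b]|[x b] /and3P[xK ub /eqP bK]] /=.
  case: (boolP (x \in b)) => /= xb; last first.
    rewrite andbCA; congr (_ && _).
    apply/andP/eqP => [[xK /eqP bK]|<-].
      by apply/setP=> y; rewrite !inE; move/setP/(_ y): bK; rewrite !inE; case: eqVneq => // ->.
    split; first by rewrite !inE eqxx.
    by apply/eqP/setP=> y; rewrite !inE; case: eqVneq => // ->; rewrite (negPf xb).
  apply/and3P => -[_ _ /eqP/setP/(_ x)]; by rewrite !inE xb eqxx.
by rewrite big_cons -scalerAr scalerA -exprD bK below_setD1id.
Qed.

(** Rewrites the recursive inversion number as a count of pairs of indices, the form of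
    [perm_length]. *)
Lemma inv_seq_map (I : finType) c (lt : rel I) (f : I -> 'I_c) (s : seq I) :
  uniq (map f s) -> pairwise lt s -> (forall x y, lt x y -> ~~ lt y x) ->
  inv_seq (map f s) = (\sum_(i <- s) \sum_(j <- s) (lt i j && (f j < f i)))%N.
Proof.
move=> + + lt_asym; elim: s => [|x s IHs] /=; first by rewrite big_nil.
case/andP=> xs us /andP[/allP xlt slt]; rewrite IHs // big_cons big_cons ltnn andbF add0n.
congr (_ + _)%N.
  rewrite /below (eq_bigl (mem (map f s))); last by move=> y; rewrite inE.
  rewrite -big_uniq //= big_map big_seq [RHS]big_seq.
  by apply: eq_bigr => y ys; rewrite xlt.
rewrite big_seq [RHS]big_seq; apply: eq_bigr => y ys.
by rewrite big_cons (negPf (lt_asym _ _ (xlt _ ys))).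
Qed.

Definition qdet m n (X : 'I_m -> 'I_n -> S) (J : {ffun 'I_m -> 'I_n}) : S :=
  \sum_(s : {perm 'I_m}) (- u) ^+ perm_length s *: \prod_i X i (J (s i)).

Definition supp m n (J : {ffun 'I_m -> 'I_n}) : {set 'I_n} := J @: setT.

Lemma is_Pi_ltn m n (J : {ffun 'I_m -> 'I_n}) i j :
  is_Pi J -> (J i < J j)%N = (i < j)%N.
Proof.
move=> /forallP/= JPi; case: (ltngtP i j) => [ij|ji|/val_inj->]; last by rewrite ltnn.
  by have /forallP/(_ j)/implyP/(_ ij) := JPi i.
by have /forallP/(_ i)/implyP/(_ ji) := JPi j; case: ltngtP.
Qed.

Lemma is_Pi_inj m n (J : {ffun 'I_m -> 'I_n}) : is_Pi J -> injective J.
Proof.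
move=> JPi i j Jij; apply: val_inj.
by case: (ltngtP i j) => //; rewrite -!(is_Pi_ltn _ _ JPi) Jij ltnn.
Qed.

(** As [J] is increasing, the sequence of the [J (s i)] has the same inversions as [s], and every
    duplicate-free sequence with set [supp J] arises from one such [s]. *)
Lemma qdet_minor m n (X : 'I_m -> 'I_n -> S) (J : {ffun 'I_m -> 'I_n}) :
  is_Pi J -> qdet X J = minor X (enum 'I_m) (supp J).
Proof.
move=> JPi; have Jinj := is_Pi_inj JPi.
have enum_ltn : pairwise (fun i j : 'I_m => (i < j)%N) (enum 'I_m).
  have := iota_ltn_sorted 0 m; rewrite -val_enum_ord sorted_pairwise; last exact: ltn_trans.
  by rewrite pairwise_map.
have Jmap_uniq (s : {perm 'I_m}) : uniq [seq J (s i) | i <- enum 'I_m].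
  by rewrite map_inj_uniq ?enum_uniq // => i j /Jinj/perm_inj.
pose h (s : {perm 'I_m}) := map_tuple (fun i => J (s i)) (in_tuple (enum 'I_m)).
have h_inj : injective h.
  move=> s t /(congr1 val)/eq_in_map st; apply/permP => i.
  by apply: Jinj; apply: st; rewrite mem_enum.
rewrite minor_expand (eq_bigl (mem (h @: setT))) => [|b].
  rewrite big_imset /=; last by move=> s t _ _ /h_inj.
  apply: eq_big => [s|s _]; first by rewrite inE.
  rewrite (inv_seq_map (lt := fun i j : 'I_m => (i < j)%N)) //; last first.
    by move=> i j ij; rewrite -leqNgt ltnW.
  congr (_ ^+ _ *: _).
    rewrite /perm_length -sum1_card.
    rewrite (eq_bigl (fun p : 'I_m * 'I_m => (p.1 < p.2) && (s p.2 < s p.1))%N).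
      rewrite big_mkcond /= -(pair_big xpredT xpredT (fun i j : 'I_m =>
          if (i < j)%N && (s j < s i)%N then 1%N else 0%N)) /= big_enum.
      apply: eq_bigr => i _; rewrite big_enum; apply: eq_bigr => j _ /=.
      by rewrite is_Pi_ltn //; case: (_ && _).
    by move=> p; rewrite inE.
  transitivity (\prod_(i <- enum 'I_m) X i (J (s i))).
    by rewrite [index_enum _]unlock -enumT.
  by rewrite /=; elim: (enum _) => [|i l IHl]; rewrite ?big_nil //= !big_cons IHl.
apply/idP/imsetP => [/andP[ub /eqP bJ]|[s _ ->]]; last first.
  rewrite Jmap_uniq; apply/eqP/setP => y; rewrite inE.
  apply/mapP/imsetP => [[i _ ->]|[i _ ->]]; first by exists (s i); rewrite ?inE.
  by exists ((s^-1)%g i); rewrite ?inE ?mem_enum ?permKV.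
have szm : size (enum 'I_m) = m by rewrite size_enum_ord.
(* The given sequence lifts through [J] to an injective self-map of ['I_m], hence to a
   permutation. *)
pose g (i : 'I_m) : 'I_n := tnth b (cast_ord (esym szm) i).
have gJ i : exists k, J k == g i.
  have : g i \in supp J by rewrite -bJ inE mem_tnth.
  by case/imsetP=> k _ ->; exists k.
pose t i := xchoose (gJ i).
have Jt i : J (t i) = g i by apply/eqP; apply: (xchooseP (gJ i)).
have t_inj : injective t.
  by move=> i j /(congr1 J); rewrite !Jt => /(tuple_uniqP _ ub)/cast_ord_inj.
exists (perm t_inj); rewrite ?inE //; apply: eq_from_tnth => k.
rewrite tnth_map permE Jt /g; congr tnth; apply: val_inj => /=.
have km : (k < m)%N by rewrite -[X in (_ < X)%N]szm.
by rewrite (tnth_nth (Ordinal km)) /= nth_enum_ord.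
Qed.

End QDet.

(** * Straightening *)

Section Straightening.
Variables (A : comUnitRingType) (F : fieldType) (iota : {rmorphism A -> F}).
Variables (u : A) (m n : nat).
Hypothesis uU : u \is a GRing.unit.
Local Notation uF := (iota u).

Lemma iota_unit_neq0 : uF != 0.
Proof. by rewrite -unitfE rmorph_unit. Qed.
Let uF0 := iota_unit_neq0.

Definition is_std (LM : {ffun 'I_m -> 'I_n} * {ffun 'I_m -> 'I_n}) : bool :=
  [&& is_Pi LM.1, is_Pi LM.2 & le_st LM.1 LM.2].

(** An expression in the matrix entries, evaluated in all algebras at once. *)
Definition universal := forall S : algType F, ('I_m -> 'I_n -> S) -> S.

(** The coefficients are quantified before the algebra. The same [k] serves in the presented algebra
    and in every representation, so it can be determined in the latter. *)
Definition straightens (p : universal) : Prop :=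
  exists k : {ffun 'I_m -> 'I_n} -> {ffun 'I_m -> 'I_n} -> A,
    forall (S : algType F) (X : 'I_m -> 'I_n -> S), qmat uF X ->
      p S X = \sum_(LM | is_std LM)
        iota (k LM.1 LM.2) *: (qdet uF X LM.1 * qdet uF X LM.2).

Lemma straightens_ext (p q : universal) :
  (forall (S : algType F) (X : 'I_m -> 'I_n -> S), qmat uF X -> p S X = q S X) ->
  straightens p -> straightens q.
Proof. by move=> pq [k kP]; exists k => S X qX; rewrite -pq // kP. Qed.

Lemma straightens0 : straightens (fun S X => 0).
Proof.
by exists (fun _ _ => 0) => S X _; rewrite big1 // => LM _; rewrite rmorph0 scale0r.
Qed.

Lemma straightensZ a (p : universal) :
  straightens p -> straightens (fun S X => iota a *: p S X).
Proof.
move=> [k kP]; exists (fun L M => a * k L M) => S X qX.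
by rewrite kP // scaler_sumr; apply: eq_bigr => LM _; rewrite rmorphM scalerA.
Qed.

Lemma straightens_sum (T : finType) (P : pred T) (p : T -> universal) :
  (forall t, P t -> straightens (p t)) ->
  straightens (fun S X => \sum_(t | P t) p t S X).
Proof.
move=> pP; have /fin_all_exists[k kP] t : exists k, P t ->
    forall (S : algType F) (X : 'I_m -> 'I_n -> S), qmat uF X ->
      p t S X = \sum_(LM | is_std LM)
        iota (k LM.1 LM.2) *: (qdet uF X LM.1 * qdet uF X LM.2).
  case: (boolP (P t)) => [/pP[k kP]|_]; first by exists k.
  by exists (fun _ _ => 0).
exists (fun L M => \sum_(t | P t) k t L M) => S X qX.
under eq_bigr => t Pt do rewrite (kP t Pt S X qX).
rewrite exchange_big; apply: eq_bigr => LM _.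
by rewrite rmorph_sum scaler_suml.
Qed.

(** A maximal minor for a sequence of columns, written through the transpose as in the Plücker
    relations. *)
Definition colminor (S : algType F) (X : 'I_m -> 'I_n -> S) (a : seq 'I_n) : S :=
  minor uF (fun j i => X i j) a setT.

Lemma qdet_col (S : algType F) (X : 'I_m -> 'I_n -> S) J :
  qmat uF X -> is_Pi J -> qdet uF X J = colminor X (enum (supp J)).
Proof.
move=> qX JPi; rewrite qdet_minor // /colminor -minor_tr //.
by congr minor; rewrite enum_setT enumT.
Qed.

Lemma colminor_cat (S : algType F) (X : 'I_m -> 'I_n -> S) (P Q : {set 'I_n}) : qmat uF X ->
  colminor X (enum P ++ enum Q) = if [disjoint P & Q]
    then (- uF) ^+ inv_seq (enum P ++ enum Q) *: colminor X (enum (P :|: Q)) else 0.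
Proof.
move=> qX; have qXt := qmat_tr qX; case: ifP => PQ.
  rewrite /colminor minor_sort // ?cat_uniq ?enum_uniq.
    have -> // : [set y in enum P ++ enum Q] = P :|: Q.
    by apply/setP => y; rewrite !inE mem_cat !mem_enum.
  rewrite /= andbT; apply/hasPn => y; rewrite !mem_enum => yQ.
  by apply/negP => yP; move/pred0P/(_ y): PQ; rewrite /= yP yQ.
apply: minor_notuniq => //; apply/negP; rewrite cat_uniq => /and3P[_ /hasPn hPQ _].
move/negP: PQ; apply; apply/pred0P => y /=; apply/negP => /andP[yP yQ].
by have := hPQ y; rewrite !mem_enum yP yQ => /(_ isT).
Qed.

Lemma colminor_size0 (S : algType F) (X : 'I_m -> 'I_n -> S) (P : {set 'I_n}) :
  #|P| != m -> colminor X (enum P) = 0.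
Proof. by move=> Pm; apply: minor_size0; rewrite -cardE cardsT card_ord. Qed.

Lemma supp_exists (K : {set 'I_n}) :
  #|K| = m -> exists2 J : {ffun 'I_m -> 'I_n}, is_Pi J & supp J = K.
Proof.
move=> Km; pose J : {ffun 'I_m -> 'I_n} := [ffun i => enum_val (cast_ord (esym Km) i)].
exists J; last first.
  apply/setP => y; apply/imsetP/idP => [[i _ ->]|yK]; first by rewrite ffunE enum_valP.
  exists (cast_ord Km (enum_rank_in yK y)) => //.
  by rewrite ffunE cast_ordK enum_rankK_in.
apply/forallP => i; apply/forallP => j; apply/implyP => ij; rewrite !ffunE.
rewrite !(enum_val_nth (J i)).
apply: (sorted_ltn_nth (leT := relpre val ltn)) => //=.
- by move=> y x z /=; apply: ltn_trans.
- exact: enum_sorted.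
- by rewrite inE -cardE Km.
- by rewrite inE -cardE Km.
Qed.

Definition weight (K : {set 'I_n}) : nat := (\sum_(x in K) x)%N.

Lemma weightU (P Q : {set 'I_n}) :
  [disjoint P & Q] -> weight (P :|: Q) = (weight P + weight Q)%N.
Proof.
by move=> PQ; rewrite /weight -bigU //; apply: eq_bigl => x; rewrite !inE.
Qed.

(** Away from the common part of [P] and [U], elements of [U], all above [t], are replaced by
    equally many elements that are at most [t]. *)
Lemma weight_exchange (P T U : {set 'I_n}) (t : 'I_n) :
  P \subset T :|: U -> #|P| = #|U| -> P != U ->
  (forall x, x \in T -> (x <= t)%N) -> (forall x, x \in U -> (t < x)%N) ->
  (weight P < weight U)%N.
Proof.
move=> PTU PU PneU Tt Ut; rewrite /weight (big_setID U) /= [X in (_ < X)%N](big_setID P) /=.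
rewrite setIC ltn_add2l.
have cPU : #|P :\: U| = #|U :\: P|.
  by have := cardsID U P; have := cardsID P U; rewrite setIC PU; lia.
have UP0 : (0 < #|U :\: P|)%N.
  rewrite card_gt0; apply: contraNneq PneU => UP; rewrite eq_sym eqEcard PU leqnn andbT.
  by rewrite -setD_eq0 UP.
have le1 : (\sum_(x in P :\: U) x <= #|P :\: U| * t)%N.
  rewrite -sum_nat_const; apply: leq_sum => x; rewrite inE => /andP[xU /(subsetP PTU)].
  by rewrite inE (negPf xU) orbF => /Tt.
have le2 : (#|U :\: P| * t.+1 <= \sum_(x in U :\: P) x)%N.
  by rewrite -sum_nat_const; apply: leq_sum => x; rewrite inE => /andP[_ /Ut].
apply: leq_ltn_trans le1 (leq_trans _ le2); by rewrite cPU ltn_pmul2l.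
Qed.

Lemma straightening I J : is_Pi I -> is_Pi J ->
  straightens (fun S X => qdet uF X I * qdet uF X J).
Proof.
have [N] := ubnP (weight (supp I)); elim: N I J => // N IHN I J; rewrite ltnS => IN IPi JPi.
have [IJ|] := boolP (le_st I J).
  exists (fun L M => ((L, M) == (I, J))%:R) => S X _.
  rewrite (bigD1 (I, J)) /=; last by rewrite /is_std IPi JPi.
  rewrite eqxx rmorph1 scale1r big1 ?addr0 // => -[L M] /andP[_ /negPf LM] /=.
  by rewrite LM rmorph0 scale0r.
rewrite negb_forall => /existsP[s]; rewrite -ltnNge => JsIs.
have Iinj := is_Pi_inj IPi; have Jinj := is_Pi_inj JPi.
(* Exchange along K = {J_t | t <= s} + {I_t | s <= t}, of size m + 1: every term
   but [I][J] moves smaller elements into the first factor. *)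
pose lo := [set t : 'I_m | (t < s)%N]; pose lo' := [set t : 'I_m | (t <= s)%N].
pose hi := [set t : 'I_m | (s < t)%N]; pose hi' := [set t : 'I_m | (s <= t)%N].
pose T := J @: lo'; pose U := I @: hi'; pose I1 := I @: lo; pose J3 := J @: hi.
have TJ x : x \in T -> (x <= J s)%N.
  by case/imsetP=> t; rewrite inE => ts ->; rewrite leqNgt is_Pi_ltn // -leqNgt.
have UJ x : x \in U -> (J s < x)%N.
  case/imsetP=> t; rewrite inE => ts ->; apply: leq_trans JsIs _.
  by rewrite leqNgt is_Pi_ltn // -leqNgt.
have disj (P Q : {set 'I_n}) (t : nat) : (forall x, x \in P -> (x < t)%N) ->
    (forall x, x \in Q -> (t <= x)%N) -> [disjoint P & Q].
  move=> Pt Qt; apply/pred0P => x /=; apply/negP => /andP[/Pt + /Qt]; lia.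
have TU : [disjoint T & U] by apply: (disj _ _ (J s).+1).
have cTU : #|T :|: U| = m.+1.
  move: TU; rewrite -leq_card_setU => /eqP ->; rewrite !card_imset // -cardsUI.
  have -> : lo' :|: hi' = setT by apply/setP => t; rewrite !inE leq_total.
  have -> : lo' :&: hi' = [set s].
    by apply/setP => t; rewrite !inE -eqn_leq.
  by rewrite cardsT card_ord cards1 addn1.
have I1U : I1 :|: U = supp I.
  rewrite -imsetU; have -> // : lo :|: hi' = setT.
  by apply/setP => t; rewrite !inE; case: ltnP.
have TJ3 : T :|: J3 = supp J.
  rewrite -imsetU; have -> // : lo' :|: hi = setT.
  by apply/setP => t; rewrite !inE; case: leqP.
have dI1U : [disjoint I1 & U].
  apply: (disj _ _ (I s)) => x /imsetP[t]; rewrite inE => ts ->; first by rewrite is_Pi_ltn.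
  by rewrite leqNgt is_Pi_ltn // -leqNgt.
have dTJ3 : [disjoint T & J3].
  apply: (disj _ _ (J s).+1) => // x /imsetP[t]; rewrite inE => ts ->.
  by rewrite is_Pi_ltn.
have cI1U : (#|I1| + #|U| = m)%N.
  by move: dI1U; rewrite -leq_card_setU => /eqP <-; rewrite I1U card_imset // cardsT card_ord.
set K := T :|: U in cTU.
pose t (P : {set 'I_n}) : universal := fun S X =>
  colminor X (enum I1 ++ enum P) * colminor X (enum (K :\: P) ++ enum J3).
(* A term survives only if both unions are disjoint and of size [m]. It is then a power of [- u]
   times a product [[I'][J']] with [I'] of smaller weight. *)
have t_straight (P : {set 'I_n}) : P \subset K -> P != U -> straightens (t P).
  move=> PK PU.
  have [dI1P|ndI1P] := boolP [disjoint I1 & P]; last first.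
    apply: straightens_ext straightens0 => S X qX.
    by rewrite /t colminor_cat // (negPf ndI1P) mul0r.
  have [dPJ3|ndPJ3] := boolP [disjoint K :\: P & J3]; last first.
    apply: straightens_ext straightens0 => S X qX.
    by rewrite /t [X in _ = _ * X]colminor_cat // (negPf ndPJ3) mulr0.
  set e1 := inv_seq (enum I1 ++ enum P).
  set e2 := inv_seq (enum (K :\: P) ++ enum J3).
  apply: (@straightens_ext (fun S X => iota ((- u) ^+ (e1 + e2)) *:
     (colminor X (enum (I1 :|: P)) * colminor X (enum (K :\: P :|: J3))))).
    move=> S X qX; rewrite /t !colminor_cat // dI1P dPJ3 -/e1 -/e2.
    by rewrite -scalerAl -scalerAr scalerA -exprD rmorphXn rmorphN.
  apply: straightensZ.
  have [c1|nc1] := eqVneq #|I1 :|: P| m; last first.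
    by apply: straightens_ext straightens0 => S X qX; rewrite colminor_size0 ?mul0r.
  have [c2|nc2] := eqVneq #|K :\: P :|: J3| m; last first.
    apply: straightens_ext straightens0 => S X qX.
    by rewrite [X in _ = _ * X]colminor_size0 ?mulr0.
  have [I' I'Pi I'P] := supp_exists c1; have [J' J'Pi J'P] := supp_exists c2.
  apply: (@straightens_ext (fun S X => qdet uF X I' * qdet uF X J')).
    by move=> S X qX; rewrite !qdet_col // I'P J'P.
  apply: IHN => //; apply: leq_trans IN; rewrite I'P -I1U !weightU // ltn_add2l.
  apply: (@weight_exchange _ T _ (J s)) => //.
  by apply/eqP; rewrite -(eqn_add2l #|I1|) cI1U -c1 eq_sym leq_card_setU.
set eU := inv_seq (enum I1 ++ enum U); set eT := inv_seq (enum T ++ enum J3).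
(* The term [P = U] is [[I][J]] times this factor. It is a unit of [A], so solving the relation for
   [[I][J]] keeps all coefficients in [A]. *)
pose w := (- u) ^+ (cross U T + (eU + eT)).
have wU : w \is a GRing.unit by rewrite unitrX // unitrN.
apply: (@straightens_ext (fun S X => iota (- w^-1) *:
   \sum_(P : {set 'I_n} | (P \subset K) && (P != U))
      iota ((- u) ^+ cross P (K :\: P)) *: t P S X)); last first.
  apply/straightensZ/straightens_sum => P /andP[PK PU].
  by apply/straightensZ/t_straight.
move=> S X qX.
have KU : K :\: U = T.
  by rewrite setDUl setDv setU0; apply/setDidPl.
have := plucker uF0 qX (enum I1) (enum J3) (_ : m < #|K|)%N.
rewrite cTU ltnSn => /(_ isT); rewrite (bigD1 U) ?subsetUr //= KU.
rewrite -/(colminor X _) -/(colminor X _) !colminor_cat // dI1U dTJ3.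
rewrite I1U TJ3 -!qdet_col // -/eU -/eT -scalerAl -scalerAr !scalerA -!exprD -addnA => /eqP.
rewrite addr_eq0 => /eqP h.
rewrite rmorphN scaleNr -scalerN.
under eq_bigr => P _ do rewrite rmorphXn rmorphN.
rewrite -h scalerA -rmorphN -rmorphXn -rmorphM mulVr // rmorph1 scale1r //.
Qed.

End Straightening.

(** * Block representations *)

Section BlockStep.
Variables (F : fieldType) (q : F) (d : nat).
Hypothesis q0 : q != 0.
Local Notation M := 'M[F]_d.+1.
(** This size is convertible to [d.+1 + d.+1] and is visibly a successor, as the ring structure on
    square matrices requires. *)
Local Notation M2 := 'M[F]_((d + d.+1).+1).

Definition utri (a b c : M) : M2 := @block_mx F d.+1 d.+1 d.+1 d.+1 a b 0 c.

Lemma utriM a b c a' b' c' :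
  utri a b c * utri a' b' c' = utri (a * a') (a * b' + b * c') (c * c').
Proof.
have := @mulmx_block F d.+1 d.+1 d.+1 d.+1 d.+1 d.+1 a b 0 c a' b' 0 c'.
by rewrite !mul0mx !mulmx0 !addr0 !add0r; apply.
Qed.

Lemma utriZ k a b c : k *: utri a b c = utri (k *: a) (k *: b) (k *: c).
Proof.
by have := @scale_block_mx F d.+1 d.+1 d.+1 d.+1 k a b 0 c; rewrite scaler0.
Qed.

Lemma utriB a b c a' b' c' :
  utri a b c - utri a' b' c' = utri (a - a') (b - b') (c - c').
Proof.
have := @add_block_mx F d.+1 d.+1 d.+1 d.+1 a b 0 c (- a') (- b') 0 (- c').
have := @opp_block_mx F d.+1 d.+1 d.+1 d.+1 a' b' 0 c'.
by rewrite /utri oppr0 addr0 => -> ->.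
Qed.

Lemma utri_eq0 a b c : (utri a b c == 0) = [&& a == 0, b == 0 & c == 0].
Proof.
apply/eqP/and3P => [|[/eqP-> /eqP-> /eqP->]]; last exact: (@block_mx0 F d.+1 d.+1 d.+1 d.+1).
move=> h; have := @eq_block_mx _ d.+1 d.+1 d.+1 d.+1 a b 0 c 0 0 0 0.
by rewrite block_mx0 => /(_ h)[-> -> _ ->]; rewrite eqxx.
Qed.

Lemma utri1 : utri 1 0 1 = 1.
Proof. by rewrite /utri -scalar_mx_block. Qed.

Variables (m n : nat) (X : 'I_m -> 'I_n -> M) (j j' : 'I_n).
Hypotheses (qX : qmat q X) (jS : j' = j.+1 :> nat).

(* X times the elementary matrix with block [[k, z], [0, k']] in columns j, j+1,
   where k = diag(q, 1), k' = diag(1, q) and z = E_01; these satisfy the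
   relations of the 2 x 2 case. *)
Definition step_mat (i : 'I_m) (l : 'I_n) : M2 :=
  utri ((if l == j then q else 1) *: X i l)
       (if l == j' then X i j else 0)
       ((if l == j' then q else 1) *: X i l).

(** The diagonal blocks inherit the relations, being scalar multiples of [X]. The off-diagonal block
    of a product involves column [j'] replaced by [j]; no column lies strictly between them, so the
    order relative to any other column is kept. The cases of [j] with [j'], or of [j'] twice, are
    balanced by the factors [q]. *)
Lemma qmat_step : qmat q step_mat.
Proof.
case: qX => h1 h2 h3 h4; rewrite /step_mat.
have jj' : (j < j')%N by rewrite jS.
have neqj : (j == j') = false by apply/eqP => /(congr1 val) /=; lia.
have ltj' (l : 'I_n) : (l < j')%N -> l != j -> (l < j)%N.
  by rewrite jS ltnS ltn_neqAle => -> lj; rewrite andbT.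
split.
- move=> i l l' ll'; rewrite !utriM utriZ; congr utri.
  + by rewrite -!scalerAl -!scalerAr !scalerA h1 // scalerA; congr (_ *: _); ring.
  + case: (eqVneq l' j') => [l'j'|l'j'].
      have -> : (l == j') = false by apply/eqP => lj; rewrite lj l'j' ltnn in ll'.
      rewrite mul0r addr0 mulr0 add0r scale1r; case: eqVneq => [->|lj].
        by rewrite -scalerAl.
      by rewrite scale1r h1 // ltj' // -l'j'.
    rewrite mulr0 add0r mul0r addr0; case: (eqVneq l j') => [lj'|lj'];
      last by rewrite mul0r mulr0 scaler0.
    have jl' : (j < l')%N by rewrite (ltn_trans jj') // -lj'.
    have -> : (l' == j) = false by apply/eqP => lj; rewrite lj ltnn in jl'.
    by rewrite !scale1r h1.
  + by rewrite -!scalerAl -!scalerAr !scalerA h1 // scalerA; congr (_ *: _); ring.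
- move=> i k l ik; rewrite !utriM utriZ; congr utri.
  + by rewrite -!scalerAl -!scalerAr !scalerA h2 // scalerA; congr (_ *: _); ring.
  + case: (eqVneq l j') => [->|lj']; last by rewrite !mulr0 !mul0r addr0 scaler0.
    rewrite eq_sym neqj !scale1r -!scalerAr (h3 _ _ _ _ ik jj').
    have -> : X i j * X k j' = X k j' * X i j + (q - q^-1) *: (X i j' * X k j).
      by rewrite -(h4 _ _ _ _ ik jj') addrC subrK.
    rewrite !scalerDr !scalerA addrCA; congr (_ + _).
    by rewrite -{1}[_ * X k j]scale1r -scalerDl; congr (_ *: _); field.
  + by rewrite -!scalerAl -!scalerAr !scalerA h2 // scalerA; congr (_ *: _); ring.
- move=> i k l l' ik ll'; rewrite !utriM; congr utri.
  + by rewrite -!scalerAl -!scalerAr !scalerA h3 // mulrC.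
  + case: (eqVneq l' j') => [l'j'|l'j'].
      have -> : (l == j') = false by apply/eqP => lj; rewrite lj l'j' ltnn in ll'.
      rewrite mul0r addr0 mulr0 add0r scale1r; case: eqVneq => [->|lj].
        by rewrite -scalerAl (h2 _ _ _ ik).
      by rewrite scale1r h3 // ltj' // -l'j'.
    rewrite mulr0 add0r mul0r addr0; case: (eqVneq l j') => [lj'|lj']; last by rewrite mul0r mulr0.
    have jl' : (j < l')%N by rewrite (ltn_trans jj') // -lj'.
    have -> : (l' == j) = false by apply/eqP => lj; rewrite lj ltnn in jl'.
    by rewrite !scale1r h3.
  + by rewrite -!scalerAl -!scalerAr !scalerA h3 // mulrC.
- move=> i k l l' ik ll'; rewrite !utriM utriB utriZ; congr utri.
  + rewrite -!scalerAl -!scalerAr !scalerA mulrC -scalerBr h4 // scalerA; congr (_ *: _); ring.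
  + case: (eqVneq l' j') => [l'j'|l'j'].
      have -> : (l == j') = false by apply/eqP => lj; rewrite lj l'j' ltnn in ll'.
      rewrite !(mul0r, mulr0, addr0, add0r) !scale1r; case: eqVneq => [->|lj].
        rewrite -scalerAl h2 // scalerA -{2}[X k j * _]scale1r -scalerBl scalerA.
        by congr (_ *: _); field.
      by rewrite scale1r h4 // ltj' // -l'j'.
    rewrite !(mul0r, mulr0, addr0, add0r).
    case: (eqVneq l j') => [lj'|lj']; last by rewrite !(mul0r, mulr0, subr0, scaler0).
    have jl' : (j < l')%N by rewrite (ltn_trans jj') // -lj'.
    have -> : (l' == j) = false by apply/eqP => lj; rewrite lj ltnn in jl'.
    by rewrite !scale1r h4.
  + rewrite -!scalerAl -!scalerAr !scalerA mulrC -scalerBr h4 // scalerA; congr (_ *: _); ring.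
Qed.
End BlockStep.

(** * Representations attached to a pair [L <= N] *)

Section FlagRep.
Variables (F : fieldType) (q : F).
Hypothesis q0 : q != 0.

Lemma prod_utri_diag d (I : eqType) (r : seq I) (a c : I -> 'M[F]_d.+1) :
  \prod_(i <- r) utri (a i) 0 (c i) = utri (\prod_(i <- r) a i) 0 (\prod_(i <- r) c i).
Proof.
elim: r => [|i r IHr]; first by rewrite !big_nil utri1.
by rewrite !big_cons IHr utriM mulr0 mul0r addr0.
Qed.

(** The single strictly block triangular factor carries the whole product into the off-diagonal
    block. *)
Lemma prod_utri_off d (I : eqType) (r : seq I) (e : I -> 'M[F]_d.+1) (s : I) :
  uniq r -> s \in r ->
  \prod_(i <- r) (if i == s then utri 0 (e i) 0 else utri (e i) 0 (e i)) =
  utri 0 (\prod_(i <- r) e i) 0.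
Proof.
elim: r => // i r IHr /= /andP[ir ur]; rewrite inE eq_sym !big_cons.
case: eqVneq => [<- _|_ /= sr]; last first.
  by rewrite IHr // utriM !mulr0 addr0.
rewrite big_seq (eq_bigr (fun k => utri (e k) 0 (e k))) => [|k kr].
  by rewrite -big_seq prod_utri_diag utriM !mul0r add0r.
by case: eqVneq => // ki; rewrite -ki kr in ir.
Qed.

(** Induction on the sum of the entries of [N]: lower [N] by one at one place and apply [step_mat]
    to the representation obtained. *)
Lemma flag_rep m n (L N : {ffun 'I_m -> 'I_n}) : is_Pi L -> is_Pi N -> le_st L N ->
  exists d (X : 'I_m -> 'I_n -> 'M[F]_d.+1),
    [/\ qmat q X, forall i j, X i j != 0 -> (L i <= j <= N i)%N
      & (\prod_i X i (L i)) * (\prod_i X i (N i)) != 0].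
Proof.
move=> LPi; have [w] := ubnP (\sum_i N i)%N; elim: w N => // w IHw N; rewrite ltnS => Nw NPi LN.
have leLN i : (L i <= N i)%N by have /forallP := LN; apply.
have [NL|NL] := eqVneq N L.
  (* For [N = L] the representation is one-dimensional. *)
  exists 0%N, (fun i l => (l == L i)%:R); split.
  - have Linj := is_Pi_inj LPi.
    split=> [i j l jl|i k j ik|i k j l ik jl|i k j l ik jl].
    + have jlF : (j == L i) && (l == L i) = false.
        by apply/negP => /andP[/eqP jL /eqP lL]; rewrite jL lL ltnn in jl.
      by rewrite -!natrM !mulnb jlF andbC jlF scaler0.
    + have ikF : (j == L i) && (j == L k) = false.
        by apply/negP => /andP[/eqP -> /eqP/Linj E]; rewrite E ltnn in ik.
      by rewrite -!natrM !mulnb ikF andbC ikF scaler0.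
    + by rewrite -!natrM mulnC.
    + rewrite -!natrM mulnC subrr mulnb; case: eqP => [El|]; last by rewrite scaler0.
      case: eqP => [Ej|]; last by rewrite scaler0.
      by move: jl; rewrite El Ej is_Pi_ltn // ltnNge (ltnW ik).
  - move=> i l; case: (eqVneq l (L i)) => [->|]; last by rewrite eqxx.
    by rewrite NL leqnn.
  - by rewrite NL !big1 ?mulr1 ?oner_eq0 // => i _; rewrite eqxx.
have [s0 s0N] : exists s, (L s < N s)%N.
  apply/existsP; apply: contraR NL; rewrite negb_exists => /forallP NL.
  apply/eqP/ffunP => i; apply: val_inj; apply/eqP.
  by rewrite eqn_leq leLN andbT leqNgt NL.
(* The entry lowered is the first one where [L] and [N] differ. Before it [N] equals [L], which
   keeps [N'] strictly increasing. *)
case: (arg_minnP (P := fun s => (L s < N s)%N) (fun s => s : nat) s0N) => s sN smin.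
have eqLN (i : 'I_m) : (i < s)%N -> L i = N i.
  move=> is_; apply: val_inj; apply/eqP; rewrite eqn_leq leLN leqNgt.
  by apply: contraL is_ => /smin; rewrite -leqNgt.
have jn : ((N s).-1 < n)%N by rewrite (leq_ltn_trans (leq_pred _)).
pose j : 'I_n := Ordinal jn.
have jS : N s = j.+1 :> nat by rewrite /= prednK //; lia.
pose N' : {ffun 'I_m -> 'I_n} := [ffun i => if i == s then j else N i].
have N'Pi : is_Pi N'.
  apply/forallP => i; apply/forallP => k; apply/implyP => ik; rewrite !ffunE.
  case: (eqVneq i s) => [i_s|i_s]; case: (eqVneq k s) => [k_s|k_s]; rewrite ?is_Pi_ltn //.
  - by rewrite i_s k_s ltnn in ik.
  - by have := ik; rewrite -(is_Pi_ltn _ _ NPi) i_s jS; apply: leq_trans.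
  - rewrite k_s in ik; rewrite -(eqLN _ ik); have := ik.
    rewrite -(is_Pi_ltn _ _ LPi); move: sN; rewrite jS; lia.
have LN' i : (L i <= N' i)%N.
  by rewrite ffunE; case: eqVneq => [->|_ //]; move: sN; rewrite jS ltnS.
have N'w : (\sum_i N' i < w)%N.
  apply: leq_trans Nw; rewrite (bigD1 s) //= [X in (_ < X)%N](bigD1 s) //= ffunE eqxx jS.
  rewrite addSn ltnS leq_add2l; apply: leq_sum => i i_s.
  by rewrite ffunE (negPf i_s).
have [|d [X [qX supX nzX]]] := IHw _ N'w N'Pi; first exact/forallP.
have X0l i (l : 'I_n) : (l < L i)%N -> X i l = 0.
  by move=> lL; apply: contraTeq lL => /supX; rewrite -leqNgt => /andP[].
have X0r i (l : 'I_n) : (N' i < l)%N -> X i l = 0.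
  by move=> lL; apply: contraTeq lL => /supX; rewrite -leqNgt => /andP[].
have NjF i : i != s -> (N i == j) = false.
  move=> i_s; apply: contraNF i_s => /eqP Nij; apply/eqP.
  by apply: (is_Pi_inj N'Pi); rewrite !ffunE eqxx Nij if_same.
have jNs : (j == N s) = false by apply/eqP => /(congr1 val) /=; lia.
exists (d + d.+1)%N, (step_mat q X j (N s)); split; first exact: qmat_step.
  move=> i l; rewrite /step_mat utri_eq0.
  have [Xil0|/supX] := eqVneq (X i l) 0.
    rewrite Xil0 !scaler0 eqxx andbT /=; case: (eqVneq l (N s)) => [->|]; last by rewrite eqxx.
    move=> /supX; rewrite ffunE; case: (eqVneq i s) => [-> _|i_s]; first by rewrite leqnn leLN.
    case/andP=> Lj jN; rewrite (leq_trans Lj) /=; last by rewrite jS.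
    rewrite jS ltn_neqAle jN andbT; apply: contraFN (NjF i i_s) => /eqP E.
    by apply/eqP/val_inj.
  case/andP=> -> lN' _ /=; apply: leq_trans lN' _; rewrite ffunE.
  by case: eqVneq => // ->; rewrite jS.
(* In row [s] the diagonal blocks vanish, since [N s] lies beyond [N' s]. In any other row [N i] is
   neither [j] nor [N s], so the matrix is block diagonal with equal blocks. *)
have -> : \prod_i step_mat q X j (N s) i (N i) = utri 0 (\prod_i X i (N' i)) 0.
  rewrite -(@prod_utri_off _ _ _ _ s) ?index_enum_uniq ?mem_index_enum //.
  apply: eq_bigr => i _; rewrite /step_mat ffunE.
  case: (eqVneq i s) => [->|i_s].
    by rewrite [N s == j]eq_sym jNs eqxx X0r ?scaler0 // ffunE eqxx jS.
  rewrite NjF // !scale1r (_ : (N i == N s) = false) ?scale1r //.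
  by apply: contraNF i_s => /eqP /(is_Pi_inj NPi) ->.
(* An off-diagonal block could occur only for [L i = N s], but then [j < L i] and [X i j] vanishes.
   The total product is therefore a nonzero multiple, in the off-diagonal block, of the one for
   [N']. *)
have -> : \prod_i step_mat q X j (N s) i (L i) =
   utri ((\prod_i (if L i == j then q else 1)) *: \prod_i X i (L i)) 0
        ((\prod_i (if L i == N s then q else 1)) *: \prod_i X i (L i)).
  rewrite -!scaler_prod -prod_utri_diag; apply: eq_bigr => i _.
  rewrite /step_mat; case: (eqVneq (L i) (N s)) => // LiNs.
  by rewrite [X in utri _ X _]X0l // LiNs jS.
rewrite utriM !mulr0 addr0 utri_eq0 eqxx /= andbT -scalerAl scaler_eq0 negb_or nzX andbT.
by apply/prodf_neq0 => i _; case: ifP; rewrite ?oner_eq0.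
Qed.
End FlagRep.

(** * Matrices vanishing to the left of L *)

Section Triangular.
Variables (F : fieldType) (q : F) (S : algType F) (m n : nat).
Hypothesis q0 : q != 0.
Variables (X : 'I_m -> 'I_n -> S) (L : {ffun 'I_m -> 'I_n}).
Hypothesis LPi : is_Pi L.

(** The values [i] and [s i] have the same sum over all indices, so no inequality is strict. *)
Lemma perm_le_id (s : {perm 'I_m}) : (forall i : 'I_m, (i <= s i)%N) -> s = 1%g.
Proof.
move=> le_s; have : (\sum_(i < m) (s i - i) == 0)%N.
  by rewrite sumnB // subn_eq0 [X in (_ <= X)%N](reindex_inj (@perm_inj _ s)).
rewrite sum_nat_eq0 => /forallP si; apply/permP => i; rewrite perm1.
by apply/val_inj/eqP; rewrite eqn_leq le_s andbT -subn_eq0 (implyP (si i)).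
Qed.

Lemma perm_length1 : perm_length (1 : {perm 'I_m})%g = 0%N.
Proof.
apply/eqP; rewrite cards_eq0; apply/eqP/setP => p; rewrite !inE !perm1.
by case: ltngtP.
Qed.

(** If [J i < I i], then [s] maps the indices from [i] on injectively into those after [i]. *)
Lemma le_st_perm (I J : {ffun 'I_m -> 'I_n}) (s : {perm 'I_m}) :
  is_Pi I -> is_Pi J -> (forall i, (I i <= J (s i))%N) -> le_st I J.
Proof.
move=> IPi JPi le_s; apply/forallP => i; rewrite leqNgt; apply/negP => JI.
pose A := [set k : 'I_m | (i <= k)%N]; pose B := [set k : 'I_m | (i < k)%N].
have sAB : s @: A \subset B.
  apply/subsetP => _ /imsetP[k + ->]; rewrite !inE => ik.
  rewrite -(is_Pi_ltn _ _ JPi) (leq_trans JI) // (leq_trans _ (le_s k)) //.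
  by rewrite leqNgt is_Pi_ltn // -leqNgt.
have := subset_leq_card sAB; rewrite card_imset; last exact: perm_inj.
have -> : A = i |: B by apply/setP => k; rewrite !inE leq_eqVlt eq_sym.
by rewrite cardsU1 inE ltnn ltnn.
Qed.

Lemma prod_eq0 (a : 'I_m -> S) i : a i = 0 -> \prod_k a k = 0.
Proof.
move=> ai; elim: (index_enum _) (mem_index_enum i) => // k r IHr.
by rewrite inE big_cons => /predU1P[<-|/IHr->]; rewrite ?ai ?mul0r ?mulr0.
Qed.

(** By [le_st_perm], every monomial of [[J]] contains a vanishing entry. *)
Lemma qdet_upper0 J :
  (forall i (j : 'I_n), (L i < j)%N -> X i j = 0) ->
  is_Pi J -> ~~ le_st J L -> qdet q X J = 0.
Proof.
move=> X0 JPi LJ; rewrite /qdet big1 // => s _.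
have [i Ji] : exists i, (L i < J (s i))%N.
  apply/existsP; apply: contraR LJ; rewrite negb_exists => /forallP Js.
  apply: (@le_st_perm _ _ s^-1) => // i.
  by have := Js (s^-1 i)%g; rewrite permKV -leqNgt.
by rewrite (@prod_eq0 _ i) ?scaler0 // X0.
Qed.

Lemma qdet_upper_diag :
  (forall i (j : 'I_n), (L i < j)%N -> X i j = 0) ->
  qdet q X L = \prod_i X i (L i).
Proof.
move=> X0; rewrite /qdet (bigD1 1%g) //= perm_length1 expr0 scale1r.
rewrite [X in _ + X]big1 ?addr0 => [|s s1]; first by apply: eq_bigr => i _; rewrite perm1.
have [i si] : exists i, (L i < L (s i))%N.
  apply/existsP; apply: contraR s1; rewrite negb_exists => /forallP Js.
  rewrite -eq_invg1; apply/eqP/perm_le_id => i.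
  by have := Js (s^-1 i)%g; rewrite permKV is_Pi_ltn // -leqNgt.
by rewrite (@prod_eq0 _ i) ?scaler0 // X0.
Qed.

Section Lower.
Hypothesis X0 : forall i (j : 'I_n), (j < L i)%N -> X i j = 0.

Lemma qdet_lower0 J : is_Pi J -> ~~ le_st L J -> qdet q X J = 0.
Proof.
move=> JPi LJ; rewrite /qdet big1 // => s _.
have [i Ji] : exists i, (J (s i) < L i)%N.
  apply/existsP; apply: contraR LJ; rewrite negb_exists => /forallP Js.
  by apply: (@le_st_perm _ _ s) => // i; rewrite leqNgt.
by rewrite (@prod_eq0 _ i) ?scaler0 // X0.
Qed.

Lemma qdet_lower_diag : qdet q X L = \prod_i X i (L i).
Proof.
rewrite /qdet (bigD1 1%g) //= perm_length1 expr0 scale1r.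
rewrite [X in _ + X]big1 ?addr0 => [|s s1]; first by apply: eq_bigr => i _; rewrite perm1.
have [i si] : exists i, (L (s i) < L i)%N.
  apply/existsP; apply: contraR s1; rewrite negb_exists => /forallP Js.
  by apply/eqP/perm_le_id => i; have := Js i; rewrite is_Pi_ltn // -leqNgt.
by rewrite (@prod_eq0 _ i) ?scaler0 // X0.
Qed.

Lemma prod_qcomm (a : 'I_m -> S) x (c : 'I_m -> F) :
  (forall i, a i * x = c i *: (x * a i)) ->
  \prod_i a i * x = (\prod_i c i) *: (x * \prod_i a i).
Proof.
move=> ax; elim: (index_enum _) => [|i r IHr]; first by rewrite !big_nil scale1r mul1r mulr1.
by rewrite !big_cons -mulrA IHr -scalerAr !mulrA ax -scalerAl scalerA mulrC.
Qed.

Lemma qcomm_prod (a : 'I_m -> S) x (c : 'I_m -> F) :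
  (forall i, x * a i = c i *: (a i * x)) ->
  x * \prod_i a i = (\prod_i c i) *: (\prod_i a i * x).
Proof.
move=> ax; elim: (index_enum _) => [|i r IHr]; first by rewrite !big_nil scale1r mul1r mulr1.
by rewrite !big_cons mulrA ax -scalerAl -!mulrA IHr -scalerAr scalerA.
Qed.

Hypothesis qX : qmat q X.

(** When [X k l] is not forced to vanish, the factor [X k (L k)] contributes [q] unless [l = L k],
    and a factor of another row with [L i = l] contributes [q^-1]. The remaining factors commute
    with [X k l]: where the commutator relation applies, its correction term contains an entry to
    the left of [L]. *)
Lemma diag_qcomm k l :
  (\prod_i X i (L i)) * X k l = q ^+ (l \notin supp L) *: (X k l * \prod_i X i (L i)).
Proof.
have [lLk|Lkl] := ltnP l (L k); first by rewrite X0 // mulr0 mul0r scaler0.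
case: qX => h1 h2 h3 h4.
pose c (i : 'I_m) := if i == k then (if l == L k then 1 else q)
            else if L i == l then q^-1 else 1.
have cP i : X i (L i) * X k l = c i *: (X k l * X i (L i)).
  rewrite /c -val_eqE; case: (ltngtP i k) => [ik|ki|/val_inj->].
  - have LiLk : (L i < L k)%N by rewrite is_Pi_ltn.
    have Lil : (L i < l)%N := leq_trans LiLk Lkl.
    have := h4 _ _ _ _ ik Lil; rewrite (X0 LiLk) mulr0 scaler0 => /eqP.
    by rewrite subr_eq0 -val_eqE ltn_eqF // scale1r => /eqP.
  - rewrite -val_eqE; case: (ltngtP (L i) l) => [Lil|lLi|/val_inj Lil].
    + by rewrite scale1r h3.
    + have := h4 _ _ _ _ ki lLi; rewrite (X0 lLi) mulr0 scaler0 => /eqP.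
      by rewrite subr_eq0 scale1r => /eqP.
    + by rewrite Lil (h2 _ _ _ ki) scalerA mulVf // scale1r.
  - case: eqVneq => [->|lLk]; first by rewrite scale1r.
    by apply: h1; rewrite ltn_neqAle Lkl andbT eq_sym.
rewrite (prod_qcomm cP); congr (_ *: _).
rewrite (bigD1 k) //= {1}/c eqxx; case: eqVneq => [lLk|lLk].
  rewrite lLk imset_f // mul1r big1 // => i ik; rewrite /c (negPf ik) lLk.
  by rewrite (inj_eq (is_Pi_inj LPi)) (negPf ik).
case: (boolP (l \in supp L)) => [/imsetP[k0 _ lLk0]|lL].
  have k0k : k0 != k by apply: contraNneq lLk => <-; rewrite lLk0.
  rewrite (bigD1 k0) //= {1}/c (negPf k0k) lLk0 eqxx mulrA divff // mul1r.
  rewrite big1 // => i /andP[ik ik0]; rewrite /c (negPf ik) lLk0.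
  by rewrite (inj_eq (is_Pi_inj LPi)) (negPf ik0).
rewrite big1 ?mulr1 // => i ik; rewrite /c (negPf ik); case: eqVneq => // Lil.
by rewrite -Lil imset_f in lL.
Qed.

(** Each monomial of [[J]] uses every column of [J] once, so all monomials acquire the same power of
    [q]. *)
Lemma qdet_lower_qcomm J : is_Pi J ->
  qdet q X L * qdet q X J =
  q ^+ (\sum_i (J i \notin supp L))%N *: (qdet q X J * qdet q X L).
Proof.
move=> JPi; rewrite qdet_lower_diag /qdet mulr_sumr mulr_suml scaler_sumr.
apply: eq_bigr => s _; rewrite -scalerAr -scalerAl scalerA mulrC -scalerA; congr (_ *: _).
rewrite (qcomm_prod (c := fun i => q ^+ (J (s i) \notin supp L))) => [|i].
  rewrite -expr_sum; congr (_ ^+ _ *: _).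
  by rewrite [RHS](reindex_inj (@perm_inj _ s)).
exact: diag_qcomm.
Qed.
End Lower.
End Triangular.

(** * The commutation relation over an arbitrary algebra *)

Lemma subn_squeeze (l l' c c' : nat) : (l <= l')%N -> (l' <= c')%N -> (c' <= c)%N ->
  (c' - l' <= c - l)%N /\ (~~ (c' - l' < c - l)%N -> l' = l /\ c' = c).
Proof. by split; lia. Qed.

Section Commutation.
Variables (A : comUnitRingType) (F : fieldType) (iota : {rmorphism A -> F}).
Variables (u : A) (m n : nat).
Hypotheses (uU : u \is a GRing.unit) (iota_inj : injective iota).
Local Notation uF := (iota u).
Local Notation idxfun := {ffun 'I_m -> 'I_n}.
Let uF0 := iota_unit_neq0 iota uU.

Lemma le_st_trans (I J K : idxfun) : le_st I J -> le_st J K -> le_st I K.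
Proof.
by move=> /forallP IJ /forallP JK; apply/forallP => i; apply: leq_trans (IJ i) (JK i).
Qed.

Lemma le_st_anti (I J : idxfun) : le_st I J -> le_st J I -> I = J.
Proof.
move=> /forallP IJ /forallP JI; apply/ffunP => i; apply/val_inj/eqP.
by rewrite eqn_leq IJ JI.
Qed.

(* The representation attached to (L, M) kills every standard product other
   than those squeezed between L and M. *)
Lemma std_coef_eq0 (p : universal F m n) (k : idxfun -> idxfun -> A)
    (bad : pred idxfun) :
  (forall (S : algType F) (X : 'I_m -> 'I_n -> S), qmat uF X ->
    p S X = \sum_(LM : idxfun * idxfun | is_std LM)
      iota (k LM.1 LM.2) *: (qdet uF X LM.1 * qdet uF X LM.2)) ->
  (forall L L', bad L -> le_st L L' -> bad L') ->
  (forall L (S : algType F) (X : 'I_m -> 'I_n -> S), bad L -> is_Pi L -> qmat uF X ->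
    (forall i (j : 'I_n), (j < L i)%N -> X i j = 0) -> p S X = 0) ->
  forall L M, is_std (L, M) -> bad L -> k L M = 0.
Proof.
move=> pk bad_up p0 L M.
have [w] := ubnP (\sum_i (M i - L i))%N; elim: w L M => // w IHw L M; rewrite ltnS => LMw.
move=> LM badL; have /and3P[/= LPi MPi leLM] := LM.
have [d [X [qX supX nzX]]] := flag_rep uF0 LPi MPi leLM.
have X0l i (l : 'I_n) : (l < L i)%N -> X i l = 0.
  by move=> lL; apply: contraTeq lL => /supX; rewrite -leqNgt => /andP[].
have X0r i (l : 'I_n) : (M i < l)%N -> X i l = 0.
  by move=> lL; apply: contraTeq lL => /supX; rewrite -leqNgt => /andP[].
have := p0 _ _ _ badL LPi qX X0l; rewrite (pk _ _ qX) (bigD1 (L, M)) //=.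
(* A squeezed pair [(L', M')] other than [(L, M)] has a smaller gap and [L'] is again bad, so its
   coefficient is zero by induction. Only the term of [(L, M)] is left, and its product is
   nonzero. *)
rewrite big1 ?addr0 => [/eqP|[L' M'] /andP[LM' neLM] /=].
  rewrite (qdet_lower_diag uF LPi X0l) (qdet_upper_diag uF MPi X0r) scaler_eq0 (negPf nzX) orbF.
  by rewrite -(rmorph0 iota) => /eqP/iota_inj.
have /and3P[/= LPi' MPi' leLM'] := LM'.
have [LL'|LL'] := boolP (le_st L L'); last first.
  by rewrite (qdet_lower0 uF LPi X0l LPi' LL') mul0r scaler0.
have [MM'|MM'] := boolP (le_st M' M); last first.
  by rewrite (qdet_upper0 uF MPi X0r MPi' MM') mulr0 scaler0.
rewrite IHw ?rmorph0 ?scale0r //; last exact: bad_up LL'.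
apply: leq_trans LMw.
have leLi i : (L i <= L' i)%N by have /forallP := LL'; apply.
have leMi i : (M' i <= M i)%N by have /forallP := MM'; apply.
have leLMi i : (L' i <= M' i)%N by have /forallP := leLM'; apply.
have [i neq_i] : exists i, (M' i - L' i < M i - L i)%N.
  apply/existsP; apply: contraR neLM; rewrite negb_exists => /forallP ge_i.
  have eq_i i : L' i = L i :> nat /\ M' i = M i :> nat.
    by have [_] := subn_squeeze (leLi i) (leLMi i) (leMi i); apply.
  by rewrite xpair_eqE; apply/andP; split; apply/eqP/ffunP => i;
    apply: val_inj; have [] := eq_i i.
rewrite (bigD1 i) //= [X in (_ < X)%N](bigD1 i) //= -addSn leq_add //.
by apply: leq_sum => l _; have [] := subn_squeeze (leLi l) (leLMi l) (leMi l).
Qed.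

Lemma commutation (I J : idxfun) : is_Pi I -> is_Pi J ->
  exists (f : int) (k : idxfun -> idxfun -> A),
    forall (S : algType F) (X : 'I_m -> 'I_n -> S), qmat uF X ->
    qdet uF X I * qdet uF X J - uF ^ f *: (qdet uF X J * qdet uF X I) =
    \sum_(LM : idxfun * idxfun | [&& is_Pi LM.1, is_Pi LM.2, lt_st LM.1 I, lt_st LM.1 J
                                   & le_st LM.1 LM.2])
      iota (k LM.1 LM.2) *: (qdet uF X LM.1 * qdet uF X LM.2).
Proof.
move=> IPi JPi.
(* For comparable [I] and [J] the exponent is that of [qdet_lower_qcomm] at the smaller one. For
   incomparable ones no bad [L] lies below both, and 0 is a default. *)
pose f : int := if le_st I J then Posz (\sum_i (J i \notin supp I))
  else if le_st J I then - Posz (\sum_i (I i \notin supp J)) else 0.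
pose p : universal F m n := fun S X =>
  qdet uF X I * qdet uF X J - uF ^ f *: (qdet uF X J * qdet uF X I).
have [k kP] : straightens iota u p.
  have [k1 k1P] := straightening iota uU IPi JPi.
  have [k2 k2P] := straightening iota uU JPi IPi.
  exists (fun L M => k1 L M - u ^ f * k2 L M) => S X qX.
  rewrite /p k1P // k2P // scaler_sumr -sumrB; apply: eq_bigr => LM _.
  by rewrite rmorphB rmorphM rmorphXz // scalerBl scalerA.
exists f, k => S X qX; rewrite -/(p S X) kP //.
rewrite (bigID (fun LM : idxfun * idxfun => lt_st LM.1 I && lt_st LM.1 J)) /=.
rewrite [X in _ + X]big1 ?addr0 => [|[L M] /andP[LM badL]] /=.
  apply: eq_bigl => LM; rewrite /is_std.
  by do !case: (is_Pi _) => //=; rewrite andbC -andbA.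
pose bad := [pred L : idxfun | ~~ (lt_st L I && lt_st L J)].
rewrite (@std_coef_eq0 p k bad) ?rmorph0 ?scale0r //.
  move=> L1 L2 /= badL1 L12; apply: contra badL1.
  have lt_trans K : lt_st L2 K -> lt_st L1 K.
    case/andP=> L2K neK; rewrite /lt_st (le_st_trans L12 L2K) /=.
    apply: contraNneq neK => L1K; apply/eqP/le_st_anti => //.
    by rewrite -L1K.
  by case/andP=> /lt_trans-> /lt_trans->.
move=> L1 {}S {}X badL1 LPi {}qX X0; rewrite /p.
(* Unless [L1] lies below both [I] and [J], both products vanish. If it does, being bad, it equals
   one of them, and skew-commutation applies. *)
have [LI|LI] := boolP (le_st L1 I); last first.
  by rewrite (qdet_lower0 uF LPi X0 IPi LI) mul0r mulr0 scaler0 subr0.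
have [LJ|LJ] := boolP (le_st L1 J); last first.
  by rewrite (qdet_lower0 uF LPi X0 JPi LJ) mul0r mulr0 scaler0 subr0.
have [eqI|neI] := eqVneq L1 I.
  rewrite eqI in LPi LJ X0; rewrite /f LJ.
  by rewrite (qdet_lower_qcomm uF0 LPi X0 qX JPi) subrr.
have eqJ : L1 = J by apply/eqP; apply: contraR badL1 => neJ; rewrite /lt_st LI neI LJ.
rewrite eqJ in LPi LI X0 neI.
have IJF : le_st I J = false by apply: contraNF neI => IJ; apply/eqP/le_st_anti.
rewrite /f IJF LI (qdet_lower_qcomm uF0 LPi X0 qX IPi) scalerA.
rewrite -exprnN mulVf ?scale1r ?subrr //; exact: expf_neq0.
Qed.
End Commutation.

(** * The algebra presented by the defining relations *)

Section Presentation.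
Variables (F : fieldType) (m n : nat) (u : F).
Local Notation P := (ncpoly F m n).
Implicit Types (p q r : P) (w : seq (idx m n)).

Lemma ncoefD p q w : ncoef (p ++ q) w = ncoef p w + ncoef q w.
Proof. by rewrite /ncoef big_cat. Qed.

Lemma ncoefZ c p w : ncoef (ncscale c p) w = c * ncoef p w.
Proof. by rewrite /ncoef big_map mulr_sumr. Qed.

Lemma ncoef_perm p q : perm_eq p q -> ncoef p =1 ncoef q.
Proof. by move=> pq w; apply: perm_big. Qed.

Lemma ncmulDl p q r : ncmul (p ++ q) r = ncmul p r ++ ncmul q r.
Proof. by rewrite /ncmul allpairs_cat. Qed.

Lemma ncmulDr p q r : perm_eq (ncmul p (q ++ r)) (ncmul p q ++ ncmul p r).
Proof. exact/permPl/(perm_allpairs_catr _ p (fun=> q) (fun=> r)). Qed.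

Lemma ncmulA p q r : ncmul p (ncmul q r) = ncmul (ncmul p q) r.
Proof.
elim: p => //= a p IHp; rewrite ncmulDl -IHp; congr (_ ++ _).
elim: q {IHp} => //= b q IHq; rewrite map_cat IHq; congr (_ ++ _).
by rewrite -map_comp; apply: eq_map => c /=; rewrite mulrA catA.
Qed.

Lemma ncmulZl c p q : ncmul (ncscale c p) q = ncscale c (ncmul p q).
Proof.
rewrite /ncmul /ncscale map_allpairs allpairs_mapl.
by apply: eq_allpairs => a b /=; rewrite mulrA.
Qed.

Lemma ncmulZr c p q : ncmul p (ncscale c q) = ncscale c (ncmul p q).
Proof.
rewrite /ncmul /ncscale map_allpairs allpairs_mapr.
by apply: eq_allpairs => a b /=; rewrite mulrCA.
Qed.

Lemma ncmul1l p : ncmul (ncword F [::]) p = p.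
Proof. by rewrite /ncmul /= cats0 -[RHS]map_id; apply: eq_map => -[c w] /=; rewrite mul1r. Qed.

Lemma ncmul1r p : ncmul p (ncword F [::]) = p.
Proof.
rewrite /ncmul /ncword allpairs1r -[RHS]map_id.
by apply: eq_map => -[c w] /=; rewrite mulr1 cats0.
Qed.

Lemma ncmul_word w w' : ncmul (ncword F w) (ncword F w') = ncword F (w ++ w').
Proof. by rewrite /ncmul /= mulr1. Qed.

Local Notation ideal_sum s := (flatten [seq ncscale t.1.1.1
  (ncmul (ncword F t.1.1.2) (ncmul t.1.2 (ncword F t.2))) | t <- s]).

Lemma in_qideal_coef p q : ncoef p =1 ncoef q -> in_qideal u p -> in_qideal u q.
Proof. by move=> pq [s [rs hs]]; exists s; split=> // w; rewrite -pq. Qed.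

Lemma in_qideal0 p : (forall w, ncoef p w = 0) -> in_qideal u p.
Proof. by move=> p0; exists [::]; split=> // w; rewrite p0 /ncoef big_nil. Qed.

Lemma in_qidealD p q : in_qideal u p -> in_qideal u q -> in_qideal u (p ++ q).
Proof.
move=> [s [rs hs]] [t [rt ht]]; exists (s ++ t); split.
  by move=> x; rewrite mem_cat => /orP[/rs|/rt].
by move=> w; rewrite map_cat flatten_cat !ncoefD hs ht.
Qed.

Lemma in_qidealZ c p : in_qideal u p -> in_qideal u (ncscale c p).
Proof.
move=> [s [rs hs]].
exists [seq (c * t.1.1.1, t.1.1.2, t.1.2, t.2) | t <- s]; split.
  by move=> _ /mapP[x /rs ? ->].
move=> w; rewrite ncoefZ hs -map_comp; elim: s {rs hs} => [|t s IHs] /=.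
  by rewrite /ncoef big_nil mulr0.
by rewrite !ncoefD mulrDr IHs !ncoefZ mulrA.
Qed.

(** Formal sums may repeat words, but a linear extension from words sees only coefficients. Hence
    products respect coefficientwise equality. *)
Lemma sum_ncoef p q (g : seq (idx m n) -> F) : ncoef p =1 ncoef q ->
  \sum_(a <- p) a.1 * g a.2 = \sum_(a <- q) a.1 * g a.2.
Proof.
move=> pq; pose W := undup (map snd p ++ map snd q).
have sumW r : {subset map snd r <= W} ->
    \sum_(a <- r) a.1 * g a.2 = \sum_(w <- W) ncoef r w * g w.
  move=> rW; rewrite (eq_bigr (fun w => \sum_(a <- r) if a.2 == w then a.1 * g w else 0)).
    rewrite exchange_big; apply: eq_big_seq => a ar /=.
    rewrite (bigD1_seq a.2) ?undup_uniq ?rW ?map_f //= eqxx big1 ?addr0 // => w.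
    by rewrite eq_sym => /negPf->.
  by move=> w _; rewrite /ncoef mulr_suml big_mkcond.
rewrite !sumW; first by apply: eq_bigr => w _; rewrite pq.
  by move=> w wq; rewrite mem_undup mem_cat wq orbT.
by move=> w wp; rewrite mem_undup mem_cat wp.
Qed.

Lemma ncoefM p q w :
  ncoef (ncmul p q) w = \sum_(a <- p) a.1 * \sum_(b <- q) b.1 * (a.2 ++ b.2 == w)%:R.
Proof.
rewrite /ncoef big_mkcond big_allpairs_dep; apply: eq_bigr => a _.
rewrite mulr_sumr; apply: eq_bigr => b _ /=.
by case: eqP; rewrite ?mulr1 // !mulr0.
Qed.

Lemma ncmul_coef p p' q q' : ncoef p =1 ncoef p' -> ncoef q =1 ncoef q' ->
  ncoef (ncmul p q) =1 ncoef (ncmul p' q').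
Proof.
move=> pp' qq' w; rewrite !ncoefM.
rewrite (sum_ncoef (fun v => \sum_(b <- q) b.1 * (v ++ b.2 == w)%:R) pp').
apply: eq_bigr => a _; congr (_ * _).
exact: (sum_ncoef (fun v => (a.2 ++ v == w)%:R) qq').
Qed.

Lemma in_qideal_mul_word w w' p :
  in_qideal u p -> in_qideal u (ncmul (ncword F w) (ncmul p (ncword F w'))).
Proof.
move=> [s [rs hs]].
exists [seq (t.1.1.1, w ++ t.1.1.2, t.1.2, t.2 ++ w') | t <- s]; split.
  by move=> _ /mapP[x /rs ? ->].
have e (v : P) : ncoef v =1 ncoef v by [].
move=> v; rewrite (ncmul_coef (e _) (ncmul_coef hs (e _))) -map_comp.
elim: s {rs hs} v => [|t s IHs] v //=.
have -> : forall a b, ncoef (ncmul (ncword F w) (ncmul (a ++ b) (ncword F w'))) v =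
   ncoef (ncmul (ncword F w) (ncmul a (ncword F w'))) v +
   ncoef (ncmul (ncword F w) (ncmul b (ncword F w'))) v.
  by move=> a b; rewrite ncmulDl (ncoef_perm (ncmulDr _ _ _)) ncoefD.
rewrite ncoefD IHs; congr (_ + _).
by rewrite ncmulZl ncmulZr -2!ncmul_word !ncmulA.
Qed.

Lemma in_qidealMl p q : in_qideal u q -> in_qideal u (ncmul p q).
Proof.
move=> qI; elim: p => [|[c w] p IHp]; first by apply: in_qideal0 => w; rewrite /ncoef big_nil.
have -> : ncmul ((c, w) :: p) q =
    ncscale c (ncmul (ncword F w) (ncmul q (ncword F [::]))) ++ ncmul p q.
  rewrite ncmul1r -ncmulZl -ncmulDl; congr ncmul.
  by rewrite /ncscale /= mulr1.
by apply: in_qidealD => //; apply/in_qidealZ/in_qideal_mul_word.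
Qed.

Lemma in_qidealMr p q : in_qideal u q -> in_qideal u (ncmul q p).
Proof.
move=> qI; elim: p => [|[c w] p IHp].
  by apply: in_qideal0 => w; rewrite ncoefM big1 // => a _; rewrite big_nil mulr0.
have E : ncoef (ncscale c (ncmul (ncword F [::]) (ncmul q (ncword F w))) ++ ncmul q p)
    =1 ncoef (ncmul q ((c, w) :: p)).
  have -> : (c, w) :: p = ncscale c (ncword F w) ++ p by rewrite /ncscale /= mulr1.
  by move=> v; rewrite (ncoef_perm (ncmulDr _ _ _)) ncmul1l ncmulZr.
apply: in_qideal_coef E _.
by apply: in_qidealD => //; apply/in_qidealZ/in_qideal_mul_word.
Qed.

Lemma ncoefB p q w : ncoef (ncsub p q) w = ncoef p w - ncoef q w.
Proof. by rewrite ncoefD ncoefZ mulN1r. Qed.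

Lemma qeq_coef p q : ncoef p =1 ncoef q -> qeq u p q.
Proof. by move=> pq; apply: in_qideal0 => w; rewrite ncoefB pq subrr. Qed.

Lemma qeq_sym p q : qeq u p q -> qeq u q p.
Proof.
move=> /(in_qidealZ (-1)); apply: in_qideal_coef => w.
by rewrite ncoefZ !ncoefB mulN1r opprB.
Qed.

Lemma qeq_trans q p r : qeq u p q -> qeq u q r -> qeq u p r.
Proof.
move=> pq qr; apply: in_qideal_coef (in_qidealD pq qr) => w.
by rewrite ncoefD !ncoefB addrA subrK.
Qed.

Lemma qeqD p p' q q' : qeq u p p' -> qeq u q q' -> qeq u (p ++ q) (p' ++ q').
Proof.
move=> pp qq; apply: in_qideal_coef (in_qidealD pp qq) => w.
by rewrite ncoefD !ncoefB !ncoefD opprD addrACA.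
Qed.

Lemma qeqZ c p p' : qeq u p p' -> qeq u (ncscale c p) (ncscale c p').
Proof.
move=> /(in_qidealZ c); apply: in_qideal_coef => w.
by rewrite ncoefZ !ncoefB !ncoefZ mulrBr.
Qed.

Lemma qeqM p p' q q' : qeq u p p' -> qeq u q q' -> qeq u (ncmul p q) (ncmul p' q').
Proof.
move=> pp qq; apply: in_qideal_coef (in_qidealD (in_qidealMl p qq) (in_qidealMr q' pp)) => w.
rewrite ncoefB ncoefD (ncoef_perm (ncmulDr _ _ _)) ncmulDl !ncoefD.
by rewrite ncmulZr ncmulZl !ncoefZ !mulN1r addrA subrK.
Qed.

(** All words in the defining relations are nonempty, so elements of the ideal have constant term
    zero. This makes the quotient a nonzero ring. *)
Lemma qeq_neq0 : ~ qeq u (ncword F [::] : P) [::].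
Proof.
case=> s [rs /(_ [::])]; rewrite ncoefB {1 2}/ncoef big_cons !big_nil eqxx addr0 subr0 /=.
have -> : ncoef (ideal_sum s) [::] = 0; last by apply/eqP; rewrite oner_eq0.
elim: s rs => [|t s IHs] rs; first by rewrite /ncoef big_nil.
rewrite /= ncoefD IHs; last by move=> x xs; apply: rs; rewrite inE xs orbT.
have t_nonnil : all (fun a => a.2 != [::]) t.1.2.
  have /rs [i [k [j [l]]]] : t \in t :: s by rewrite inE eqxx.
  by case=> [[_ _ ->]|[[_ _ ->]|[[_ _ ->]|[_ _ ->]]]].
rewrite addr0 ncoefZ ncoefM big_seq1 big1_seq ?mulr0 // => b.
case/allpairsP=> -[a1 a2] /= [/(allP t_nonnil) + _ ->] /=.
by case: a1 => ? [|? ?] //= _; case: (t.1.1.2) => [|? ?]; rewrite mulr0.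
Qed.

End Presentation.

(** * The quotient by the relations as an algebra *)

Section QMatrixAlgebra.
Local Open Scope quotient_scope.
Variables (F : fieldType) (m n : nat) (u : F).
Local Notation P := (ncpoly F m n).

(** Ideal membership is existential; classical reflection makes it the boolean relation that the
    quotient construction takes. *)
Let qeqb (p q : P) : bool := `[< qeq u p q >].

Lemma qeqb_equiv : equiv_class_of qeqb.
Proof.
split=> [p|p q|q p r]; first by apply/asboolP/qeq_coef.
  by apply/asboolP/asboolP => /qeq_sym.
by move=> /asboolP pq /asboolP qr; apply/asboolP/(qeq_trans pq qr).
Qed.

Canonical qeqb_equiv_rel := EquivRelPack qeqb_equiv.

Definition qmatalg := {eq_quot qeqb}.
HB.instance Definition _ : EqQuotient _ qeqb qmatalg := EqQuotient.on qmatalg.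
HB.instance Definition _ := Choice.on qmatalg.

Definition qproj (p : P) : qmatalg := \pi_qmatalg p.

Lemma qprojP p q : qproj p = qproj q <-> qeq u p q.
Proof.
split=> [/eqmodP/asboolP //|pq]; exact/eqmodP/asboolP.
Qed.

Lemma qprojK x : qproj (repr x) = x.
Proof. exact: reprK. Qed.

(** The operations use chosen representatives; [qaddE], [qscaleE], [qoppE] and [qmulE] show
    independence of the choice. *)
Let qadd (x y : qmatalg) := qproj (repr x ++ repr y).
Let qopp (x : qmatalg) := qproj (ncscale (-1) (repr x)).
Let qmul (x y : qmatalg) := qproj (ncmul (repr x) (repr y)).
Let qscale c (x : qmatalg) := qproj (ncscale c (repr x)).

Let qrepr p : qeq u (repr (qproj p)) p.
Proof. by apply/qprojP; rewrite qprojK. Qed.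

Let qaddE p q : qadd (qproj p) (qproj q) = qproj (p ++ q).
Proof. exact/qprojP/qeqD. Qed.

Let qscaleE c p : qscale c (qproj p) = qproj (ncscale c p).
Proof. exact/qprojP/qeqZ. Qed.

Let qoppE p : qopp (qproj p) = qproj (ncscale (-1) p).
Proof. exact/qprojP/qeqZ. Qed.

Let qmulE p q : qmul (qproj p) (qproj q) = qproj (ncmul p q).
Proof. exact/qprojP/qeqM. Qed.

Let qprojW (T : qmatalg -> Prop) : (forall p, T (qproj p)) -> forall x, T x.
Proof. by move=> H x; rewrite -(qprojK x). Qed.

Let qproj_coef p q : ncoef p =1 ncoef q -> qproj p = qproj q.
Proof. by move=> pq; apply/qprojP/qeq_coef. Qed.

Let qaddA : associative qadd.
Proof.
elim/qprojW=> p; elim/qprojW=> q; elim/qprojW=> r.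
by rewrite !qaddE catA.
Qed.

Let qaddC : commutative qadd.
Proof.
elim/qprojW=> p; elim/qprojW=> q; rewrite !qaddE; apply: qproj_coef => w.
by rewrite !ncoefD addrC.
Qed.

Let qadd0 : left_id (qproj [::]) qadd.
Proof. by elim/qprojW=> p; rewrite qaddE. Qed.

Let qaddN : left_inverse (qproj [::]) qopp qadd.
Proof.
elim/qprojW=> p; rewrite qoppE qaddE; apply: qproj_coef => w.
by rewrite ncoefD ncoefZ mulN1r addNr /ncoef big_nil.
Qed.

HB.instance Definition _ := GRing.isZmodule.Build qmatalg qaddA qaddC qadd0 qaddN.

Let qmulA : associative qmul.
Proof.
elim/qprojW=> p; elim/qprojW=> q; elim/qprojW=> r.
by rewrite !qmulE ncmulA.
Qed.

Let qmul1l : left_id (qproj (ncword F [::])) qmul.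
Proof. by elim/qprojW=> p; rewrite qmulE ncmul1l. Qed.

Let qmul1r : right_id (qproj (ncword F [::])) qmul.
Proof. by elim/qprojW=> p; rewrite qmulE ncmul1r. Qed.

Let qmulDl : left_distributive qmul qadd.
Proof.
elim/qprojW=> p; elim/qprojW=> q; elim/qprojW=> r.
by rewrite (qaddE p q) !qmulE qaddE ncmulDl.
Qed.

Let qmulDr : right_distributive qmul qadd.
Proof.
elim/qprojW=> p; elim/qprojW=> q; elim/qprojW=> r.
by rewrite (qaddE q r) !qmulE qaddE; apply/qproj_coef/ncoef_perm/ncmulDr.
Qed.

Let q1_neq0 : qproj (ncword F [::]) != qproj [::].
Proof. by apply/eqP => /qprojP; apply: qeq_neq0. Qed.

HB.instance Definition _ :=
  GRing.Zmodule_isNzRing.Build qmatalg qmulA qmul1l qmul1r qmulDl qmulDr q1_neq0.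

Let qscaleA a b x : qscale a (qscale b x) = qscale (a * b) x.
Proof.
elim/qprojW: x => p; rewrite !qscaleE; apply: qproj_coef => w.
by rewrite !ncoefZ mulrA.
Qed.

Let qscale1 : left_id 1 qscale.
Proof.
elim/qprojW=> p; rewrite qscaleE; apply: qproj_coef => w.
by rewrite ncoefZ mul1r.
Qed.

Let qscaleDr : right_distributive qscale +%R.
Proof.
move=> a; elim/qprojW=> p; elim/qprojW=> q; rewrite /GRing.add /= (qaddE p q) !qscaleE qaddE.
by apply: qproj_coef => w; rewrite ncoefD !ncoefZ ncoefD mulrDr.
Qed.

Let qscaleDl x : {morph qscale^~ x : a b / a + b}.
Proof.
move=> a b; elim/qprojW: x => p; rewrite [RHS]/GRing.add /= !qscaleE qaddE.
by apply: qproj_coef => w; rewrite ncoefD !ncoefZ mulrDl.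
Qed.

HB.instance Definition _ :=
  GRing.Zmodule_isLmodule.Build F qmatalg qscaleA qscale1 qscaleDr qscaleDl.

Let qscaleAl (a : F) (x y : qmatalg) : a *: (x * y) = a *: x * y.
Proof.
elim/qprojW: x => p; elim/qprojW: y => q.
by rewrite /GRing.scale /GRing.mul /= (qmulE p q) !qscaleE qmulE ncmulZl.
Qed.

HB.instance Definition _ := GRing.Lmodule_isLalgebra.Build F qmatalg qscaleAl.

Let qscaleAr (a : F) (x y : qmatalg) : a *: (x * y) = x * (a *: y).
Proof.
elim/qprojW: x => p; elim/qprojW: y => q.
by rewrite /GRing.scale /GRing.mul /= (qmulE p q) !qscaleE qmulE ncmulZr.
Qed.

HB.instance Definition _ := GRing.Lalgebra_isAlgebra.Build F qmatalg qscaleAr.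

Lemma qprojD p q : qproj (p ++ q) = qproj p + qproj q.
Proof. by rewrite -qaddE. Qed.

Lemma qprojM p q : qproj (ncmul p q) = qproj p * qproj q.
Proof. by rewrite -qmulE. Qed.

Lemma qprojZ c p : qproj (ncscale c p) = c *: qproj p.
Proof. by rewrite -qscaleE. Qed.

Lemma qproj0 : qproj [::] = 0.
Proof. by []. Qed.

Lemma qprojB p q : qproj (ncsub p q) = qproj p - qproj q.
Proof. by rewrite qprojD qprojZ scaleN1r. Qed.

Lemma qproj_flatten (T : Type) (s : seq T) (f : T -> P) :
  qproj (flatten [seq f t | t <- s]) = \sum_(t <- s) qproj (f t).
Proof.
by elim: s => [|t s IHs]; rewrite ?big_nil ?big_cons //= qprojD IHs.
Qed.

Definition qgen (i : 'I_m) (j : 'I_n) : qmatalg := qproj (ncword F [:: (i, j)]).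

Lemma qproj_word w : qproj (ncword F w) = \prod_(p <- w) qgen p.1 p.2.
Proof.
elim: w => [|[i j] w IHw]; first by rewrite big_nil.
by rewrite big_cons -IHw -qprojM ncmul_word.
Qed.

Lemma qproj_seq (p : P) : qproj p = \sum_(a <- p) a.1 *: \prod_(x <- a.2) qgen x.1 x.2.
Proof.
elim: p => [|[c w] p IHp]; first by rewrite big_nil.
rewrite big_cons -IHp -qproj_word -qprojZ -qprojD; congr qproj.
by rewrite /ncscale /= mulr1.
Qed.

Lemma qproj_qrel r : is_qrel u r -> qproj r = 0.
Proof.
move=> rr; rewrite -qproj0; apply/qprojP.
exists [:: (1, [::], r, [::])]; split; first by move=> t; rewrite inE => /eqP->.
move=> w; rewrite /= cats0 ncmul1l ncmul1r ncoefZ mul1r.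
by rewrite ncoefD ncoefZ /ncoef big_nil mulr0 addr0.
Qed.

End QMatrixAlgebra.

Lemma qmat_qgen (F : fieldType) (m n : nat) (u : F) : qmat u (@qgen F m n u).
Proof.
have rel r := @qproj_qrel F m n u r.
split=> [i j l jl|i k j ik|i k j l ik jl|i k j l ik jl].
- have /rel : is_qrel u [:: (1, [:: (i, j); (i, l)]); (- u, [:: (i, l); (i, j)])].
    by exists i, i, j, l; left.
  rewrite qproj_seq !big_cons !big_nil /= !mulr1 addr0 scale1r scaleNr.
  by move/eqP; rewrite subr_eq0 => /eqP.
- have /rel : is_qrel u [:: (1, [:: (i, j); (k, j)]); (- u, [:: (k, j); (i, j)])].
    by exists i, k, j, j; right; left.
  rewrite qproj_seq !big_cons !big_nil /= !mulr1 addr0 scale1r scaleNr.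
  by move/eqP; rewrite subr_eq0 => /eqP.
- have /rel : is_qrel u [:: (1, [:: (k, j); (i, l)]); (-1, [:: (i, l); (k, j)])].
    by exists k, i, j, l; right; right; left.
  rewrite qproj_seq !big_cons !big_nil /= !mulr1 addr0 scale1r scaleN1r.
  by move/eqP; rewrite subr_eq0 => /eqP.
- have /rel : is_qrel u [:: (1, [:: (i, j); (k, l)]); (-1, [:: (k, l); (i, j)]);
                (- (u - u^-1), [:: (i, l); (k, j)])].
    by exists i, k, j, l; right; right; right.
  rewrite qproj_seq !big_cons !big_nil /= !mulr1 addr0 scale1r scaleN1r.
  by rewrite [(- (_ - _)) *: _]scaleNr addrA => /eqP; rewrite subr_eq0 => /eqP.
Qed.

Lemma qproj_qminor (F : fieldType) (m n : nat) (u : F) (J : {ffun 'I_m -> 'I_n}) :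
  qproj u (qminor u J) = qdet u (@qgen F m n u) J.
Proof.
rewrite qproj_seq big_map big_enum; apply: eq_bigr => s _ /=.
by rewrite big_map [index_enum _]unlock -enumT.
Qed.

Theorem theorem3p4p4 (A : idomainType) (u : A) (m n : nat)
  (hu : u \is a GRing.unit) (hm : (0 < m)%N) (hmn : (m <= n)%N)
  (I J : {ffun 'I_m -> 'I_n}) (hI : is_Pi I) (hJ : is_Pi J) :
  let F := {fraction A} in
  let uF : F := tofrac u in
  exists (f : int) (k : {ffun 'I_m -> 'I_n} -> {ffun 'I_m -> 'I_n} -> A),
    qeq uF
      (ncsub (ncmul (qminor uF I) (qminor uF J))
             (ncscale (uF ^ f) (ncmul (qminor uF J) (qminor uF I))))
      (flatten [seq ncscale (tofrac (k LM.1 LM.2))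
                   (ncmul (qminor uF LM.1) (qminor uF LM.2))
               | LM <- enum [pred LM : {ffun 'I_m -> 'I_n} * {ffun 'I_m -> 'I_n} |
                     [&& is_Pi LM.1, is_Pi LM.2, lt_st LM.1 I, lt_st LM.1 J
                       & le_st LM.1 LM.2]]]).
Proof.
move=> F uF.
have inj : injective (@tofrac A : {rmorphism A -> {fraction A}}).
  by move=> x y /eqP; rewrite tofrac_eq => /eqP.
have [f [k kP]] := commutation hu inj hI hJ.
(* The congruence becomes an equality in [qmatalg], an instance of [commutation] for the matrix of
   generators. *)
exists f, k; apply/qprojP.
rewrite qprojB qprojZ !qprojM qproj_flatten !qproj_qminor.
rewrite (kP _ _ (qmat_qgen _ _ _)) big_enum.
by apply: eq_bigr => LM _; rewrite qprojZ qprojM !qproj_qminor.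
Qed.
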